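(* Let $S$ be an $n$-dimensional ellipsoid in $\mathbb{R}^{n+1}$. (1) If $\mathscr{L}$ is a (continuous) line bundle over an open subset $U$ of $S$ and $\mathscr{L}$ is not tangent to $U$, then $\operatorname{int}(\Delta_*\mathscr{L})\neq\varnothing$. (2) If $n\geqslant 1$ and $\mathscr{D}$ is a continuous line distribution over $S$, then $\Delta_*\mathscr{D}=\mathbb{R}^{n+1}\setminus B$, where $B$ is the open region bounded by $S$. (3) For every (continuous) line bundle $\mathscr{L}$ over $S$, $\operatorname{int}(\Delta_*\mathscr{L})\neq\varnothing$.
   Context: An $n$-dimensional ellipsoid in $\mathbb{R}^{n+1}$ is the image of the unit sphere $\mathbb{S}^n=\{x\in\mathbb{R}^{n+1}:\|x\|=1\}$ under a non-degenerate (invertible) affine transformation of $\mathbb{R}^{n+1}$; the open region bounded by it is the image of the open unit ball. A line bundle over a subset $X\subseteq\mathbb{R}^{n+1}$ means the embedded bundle $\mathscr{L}=\{(p,u)\in X\times\mathbb{R}^{n+1}: u\in\varphi(p)\}$ defined by a continuous map $\varphi:X\to\mathbb{P}^n=\operatorname{Gr}_1(n+1)$ into the space of lines through $0$ in $\mathbb{R}^{n+1}$. When $X$ is an open subset of $S$, the bundle is tangent to $X$ iff $\varphi(p)\subseteq T_pS$ for all $p\in X$; a continuous line distribution over $S$ is a line bundle over $S$ that is tangent to $S$. The codiagonal map is $\Delta_*(x,y)=x+y$, so $\Delta_*\mathscr{L}=\bigcup_{p\in X}(p+\varphi(p))\subseteq\mathbb{R}^{n+1}$. $\operatorname{int}$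 denotes interior in $\mathbb{R}^{n+1}$. *)

(* Defs.v *)
From HB Require Import structures.
From mathcomp Require Import all_boot all_order all_algebra.
From mathcomp Require Import all_classical all_reals all_analysis.

Set Implicit Arguments.
Unset Strict Implicit.
Unset Printing Implicit Defensive.

Import Order.TTheory GRing.Theory Num.Theory.
Import numFieldNormedType.Exports.

Local Open Scope classical_set_scope.
Local Open Scope ring_scope.

(* R^(n+1) is 'rV[R]_n.+1, with its library topology (the product topology);
   the library norm on it is the sup norm, hence a separate Euclidean norm. *)
Definition enorm (R : realType) (m : nat) (x : 'rV[R]_m) : R :=
  Num.sqrt (\sum_(i < m) x 0 i ^+ 2).

Definition unit_sphere (R : realType) (n : nat) : set 'rV[R]_n.+1 :=
  [set x | enorm x = 1].

Definition unit_ball (R : realType) (n : nat) : set 'rV[R]_n.+1 :=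
  [set x | enorm x < 1].

(* Nondegenerate exactly when A \in unitmx. *)
Definition affine_transform (R : realType) (n : nat) (A : 'M[R]_n.+1)
  (b x : 'rV[R]_n.+1)
  : 'rV[R]_n.+1 := x *m A + b.

Definition ellipsoid (R : realType) (n : nat) (A : 'M[R]_n.+1)
  (b : 'rV[R]_n.+1) : set 'rV[R]_n.+1 := affine_transform A b @` @unit_sphere R n.

Definition ellipsoid_region (R : realType) (n : nat) (A : 'M[R]_n.+1)
  (b : 'rV[R]_n.+1) : set 'rV[R]_n.+1 := affine_transform A b @` @unit_ball R n.

Definition Gr1 (R : realType) (n : nat) : Type :=
  {V : {vspace 'rV[R]_n.+1} | \dim V == 1%N}.

HB.instance Definition _ (R : realType) (n : nat) := Choice.on (Gr1 R n).

Lemma dim_span1 (R : realType) (n : nat) (v : 'rV[R]_n.+1) :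
  v != 0 -> \dim <[v]>%VS == 1%N.
Proof. by move=> v0; rewrite dim_vline v0. Qed.

Definition span1 (R : realType) (n : nat) (v : 'rV[R]_n.+1) (v0 : v != 0)
  : Gr1 R n := exist _ <[v]>%VS (dim_span1 v0).

(* The quotient topology for span1 : R^(n+1) \ {0} -> Gr1; since R^(n+1) \ {0}
   is open, openness of the preimage can be tested in R^(n+1). *)
Definition Gr1_open (R : realType) (n : nat) : set_system (Gr1 R n) :=
  [set W | open [set v : 'rV[R]_n.+1 | exists v0 : v != 0, W (span1 v0)]].

Section Gr1_topology.
Variables (R : realType) (n : nat).

Let Gr1_openT : @Gr1_open R n setT.
Proof.
rewrite /Gr1_open /= [X in open X](_ : _ = ~` [set 0]).
  exact/closed_openC/accessible_closed_set1/hausdorff_accessible/norm_hausdorff.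
by apply/seteqP; split=> v /= => [[/eqP]//|/eqP v0]; exists v0.
Qed.

Let Gr1_openI : setI_closed (@Gr1_open R n).
Proof.
move=> W1 W2 o1 o2; rewrite /Gr1_open /=.
have := openI o1 o2; congr open; apply/seteqP; split=> v /=.
  by move=> [[v0 W1v] [v0' W2v]]; exists v0; split=> //; rewrite (bool_irrelevance v0 v0').
by move=> [v0 [W1v W2v]]; split; exists v0.
Qed.

Let Gr1_open_bigU (I : Type) (f : I -> set (Gr1 R n)) :
  (forall i, Gr1_open (f i)) -> Gr1_open (\bigcup_i f i).
Proof.
move=> fo; rewrite /Gr1_open /=.
have := @bigcup_open _ _ setT _ (fun i _ => fo i).
congr open; apply/seteqP; split=> v /=.
  by move=> [i _ [v0 fv]]; exists v0, i.
by move=> [v0 [i _ fv]]; exists i => //; exists v0.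
Qed.

HB.instance Definition _ :=
  isOpenTopological.Build (Gr1 R n) Gr1_openT Gr1_openI Gr1_open_bigU.

End Gr1_topology.

(* T_pS as the set of velocities at p of differentiable curves lying in S; for
   an embedded submanifold S this is the tangent space, as a linear subspace. *)
Definition tangent_space (R : realType) (n : nat) (S : set 'rV[R]_n.+1)
    (p : 'rV[R]_n.+1) : set 'rV[R]_n.+1 :=
  [set u | exists gamma : R -> 'rV[R]_n.+1,
    [/\ \forall t \near (0 : R), S (gamma t) /\ derivable gamma t 1,
        gamma 0 = p & is_derive (0 : R) (1 : R) gamma u]].

(* A line bundle over X is given by phi with {within X, continuous phi}; phi is
   a total function, but only its restriction to X is ever used. *)
Definition bundle (R : realType) (n : nat) (X : set 'rV[R]_n.+1)
    (phi : 'rV[R]_n.+1 -> Gr1 R n) : set ('rV[R]_n.+1 * 'rV[R]_n.+1) :=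
  [set z | X z.1 /\ z.2 \in val (phi z.1)].

Definition tangent_bundle (R : realType) (n : nat) (S X : set 'rV[R]_n.+1)
    (phi : 'rV[R]_n.+1 -> Gr1 R n) : Prop :=
  forall p, X p -> [set` val (phi p)] `<=` tangent_space S p.

Definition codiagonal (R : realType) (n : nat)
    (z : 'rV[R]_n.+1 * 'rV[R]_n.+1) : 'rV[R]_n.+1 := z.1 + z.2.

Definition line_distribution (R : realType) (n : nat) (S : set 'rV[R]_n.+1)
    (phi : 'rV[R]_n.+1 -> Gr1 R n) : Prop :=
  {within S, continuous phi} /\ tangent_bundle S S phi.

(* Main.v *)
Require Import Defs.
From HB Require Import structures.
From mathcomp Require Import all_boot all_order all_algebra all_fingroup.
From mathcomp Require Import all_classical all_reals all_analysis.
From mathcomp Require Import zify ring lra.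

Set Implicit Arguments.
Unset Strict Implicit.
Unset Printing Implicit Defensive.

Import Order.TTheory GRing.Theory Num.Theory.
Import numFieldNormedType.Exports.

Local Open Scope classical_set_scope.
Local Open Scope ring_scope.

(** Everything is affine invariant, so the ellipsoid may be thought of as the
unit sphere; a line bundle over it is handled through its field of projection
matrices (bundle_mx), which depends continuously on the base point.

_A line transverse to the sphere._  Let the line at p be spanned by a vector
with nonzero component along p.  Projecting this fixed vector to the
neighbouring lines gives a continuous local section w, and the map
G x = x/|x| + (|x| - 1) w x sends x to a point of the affine line attached to
x/|x|.  Since w is merely continuous, G need not be C^1; but the factor
|x| - 1 vanishes at p, so G is differentiable at the single point p, with
derivative u |-> u + (u.p)(w p - p), which is invertible exactly because
w p is transverse.  Being continuous near p and differentiable at p with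
invertible derivative is enough for G to cover a neighbourhood of G p = p
(invertible_derivative_open): after inverting the derivative, G x = z becomes
a fixed point problem on a small cube.

_All lines tangent._  A tangent line at p stays outside the open ball by
Pythagoras.  Conversely let |x| > 1.  The points p with x - p tangent at p form
the horizon sphere bounding the cap of points visible from x, so one must find
p on the horizon with x - p in the line at p.  The cap is a disc, hence the
bundle has a nowhere zero section v over it (exists_section); working over the
cap rather than the whole sphere avoids having to orient the bundle.  Transported to a flat disc by
central projection from the origin, v becomes a nowhere zero planar field, and
such a field on a disc must point radially inward somewhere on the boundary
(disc_boundary_inward).  Unfolding the chart, v is then a multiple of x - p.
So the lines fill exactly the complement of the open ball.

A bundle over the whole ellipsoid is either tangent, and then it fills the
exterior, or not, and then the first case applies; this gives the last claim.

Both halves rest on the Brouwer fixed point theorem (brouwer_bounded), obtained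
from the Poincare-Miranda theorem.  The latter is proved by a discrete form of
the fact that the integral of a Jacobian determinant depends only on boundary
values: for 0/1-valued functions a_i on a grid, the sum over all grid cubes and
all monotone lattice paths through a cube of the signed products of increments
of the a_i is computed by summation by parts (sum_discrete_jacobian) and equals
1, so some small cube carries an increment of every a_i at once. *)

(** * A discrete Jacobian determinant *)

(** The l-th vertex of the monotone lattice path from x to the opposite corner of
the unit cube at x which uses the direction c at step s c; the n + 1 vertices of
such a path span one simplex of Kuhn's triangulation of the cube. *)
Definition chain n (x : 'I_n -> nat) (s : 'S_n) (l : nat) : 'I_n -> nat :=
  fun c => (x c + (s c < l))%N.

(** The cup product of the coboundaries of the a_i evaluated on the unit cube at
x: a determinant of increments, where the increment of a_i is taken along the
i-th edge of the path. *)
Definition discrete_jacobian n (a : 'I_n -> ('I_n -> nat) -> int)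
    (x : 'I_n -> nat) : int :=
  \sum_(s : 'S_n) (-1) ^+ s *
    \prod_(i < n) (a i (chain x s i.+1) - a i (chain x s i)).

Definition extend n (k : 'I_n.+1) (v : nat) (y : 'I_n -> nat) : 'I_n.+1 -> nat :=
  fun c => if unlift k c is Some c' then y c' else v.

Lemma sum_swap0 n (t : 'S_n) (F : 'S_n -> int) :
  odd_perm t -> (forall s, F (s * t)%g = F s) ->
  \sum_(s : 'S_n) (-1) ^+ s * F s = 0.
Proof.
move=> ot Ft; apply/eqP; rewrite -eqNr -sumrN eq_sym.
rewrite (reindex_inj (mulIg t)); apply/eqP/eq_bigr => s _.
by rewrite Ft odd_permM ot addbT signrN mulNr.
Qed.

Lemma chain_swap n (x : 'I_n -> nat) (s : 'S_n) (i j : 'I_n) l :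
  j = i.+1 :> nat -> l != j :> nat ->
  chain x (s * tperm i j)%g l = chain x s l.
Proof.
move=> ji lj; apply/funext => c; rewrite /chain permM; congr (_ + nat_of_bool _)%N.
case: tpermP => [->|->|//]; move/eqP: lj; rewrite ji => lj; apply/idP/idP; lia.
Qed.

(** The value of the last function at the endpoint of the path u, times the
increments of the other n functions along all the n + 1 edges of u but the j-th.
For j = n this is the upper term of a summation by parts of the last increment;
for j = 0 it lives on the path with its initial vertex deleted. *)
Definition mixed_term n (a : 'I_n.+1 -> ('I_n.+1 -> nat) -> int)
    (u : nat -> 'I_n.+1 -> nat) (j : nat) : int :=
  (\prod_(i < n) (a (lift ord_max i) (u (i + (j <= i)).+1%N)
                  - a (lift ord_max i) (u (i + (j <= i))%N)))
  * a ord_max (u n.+1).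

(** Adding the terms for j and j + 1 merges two consecutive increments of a_j into
one, and the result no longer depends on the vertex j + 1 of the path.  That
vertex is the only one affected by exchanging steps j and j + 1, which changes the
sign of the permutation, so the signed sum cancels: inner faces of the
triangulation are shared by two simplices. *)
Lemma sum_mixed_term n a (x : 'I_n.+1 -> nat) (j : nat) : (j < n)%N ->
  \sum_(s : 'S_n.+1) (-1) ^+ s * mixed_term a (chain x s) j.+1
  = - \sum_(s : 'S_n.+1) (-1) ^+ s * mixed_term a (chain x s) j.
Proof.
move=> jn; apply/eqP; rewrite -addr_eq0 -big_split /=; apply/eqP.
under eq_bigr do rewrite -mulrDr.
have j1 : (j < n.+1)%N by apply: ltnW.
pose t := tperm (Ordinal j1) (Ordinal (jn : j.+1 < n.+1)%N).
apply: (sum_swap0 (t := t)).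
  by rewrite odd_tperm; apply/eqP => -[]; lia.
pose j0 := Ordinal jn.
have E s : mixed_term a (chain x s) j.+1 + mixed_term a (chain x s) j =
  (a (lift ord_max j0) (chain x s j.+2) - a (lift ord_max j0) (chain x s j)) *
  \prod_(i < n | i != j0) (a (lift ord_max i) (chain x s (i + (j < i)).+1%N)
                  - a (lift ord_max i) (chain x s (i + (j < i))%N)) *
  a ord_max (chain x s n.+1).
  rewrite /mixed_term -mulrDl; congr (_ * _).
  rewrite (bigD1 j0)//= [X in _ + X](bigD1 j0)//= ltnn leqnn addn0 addn1.
  rewrite [X in _ + _ * X](eq_bigr (fun i : 'I_n =>
     a (lift ord_max i) (chain x s (i + (j < i)).+1%N)
                  - a (lift ord_max i) (chain x s (i + (j < i))%N))).
    by rewrite -mulrDl; congr (_ * _); ring.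
  move=> i ij; suff -> : (j <= i)%N = (j < i)%N by [].
  by rewrite leq_eqVlt eq_sym (negbTE (ij : val i != j)).
move=> s; rewrite !E.
have C l : l != j.+1 -> chain x (s * t)%g l = chain x s l.
  by move=> lj; apply: chain_swap.
rewrite !C; try by lia.
congr (_ * _ * _); apply: eq_bigr => i ij.
have {}ij : i != j :> nat by [].
by rewrite !C //; case: ltnP => ? /=; lia.
Qed.

Lemma sum_mixed_term_all n a (x : 'I_n.+1 -> nat) :
  \sum_(s : 'S_n.+1) (-1) ^+ s * mixed_term a (chain x s) n
  = (-1) ^+ n * \sum_(s : 'S_n.+1) (-1) ^+ s * mixed_term a (chain x s) 0.
Proof.
suff H j : (j <= n)%N ->
    \sum_(s : 'S_n.+1) (-1) ^+ s * mixed_term a (chain x s) j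
  = (-1) ^+ j * \sum_(s : 'S_n.+1) (-1) ^+ s * mixed_term a (chain x s) 0.
  exact: H.
elim: j => [|j IH] jn; first by rewrite expr0 mul1r.
by rewrite sum_mixed_term// IH ?(ltnW jn)// exprS -mulrA mulN1r.
Qed.

Definition push n (x : 'I_n.+1 -> nat) (k : 'I_n.+1) : 'I_n.+1 -> nat :=
  fun c => (x c + (c == k))%N.

(** The cycle c |-> c + 1, of sign (-1)^n.  It moves the last step of a path to the
front, and thereby relates the face missing the initial vertex to the translate of
a face missing the final vertex. *)
Definition rotation n : 'S_n.+1 := lift_perm ord_max ord0 1%g.

(** After its first step the rotated path follows the original one, translated in
the direction of that step. *)
Lemma chain_rotation n (x : 'I_n.+1 -> nat) (s : 'S_n.+1) l : (l <= n)%N ->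
  chain x (s * rotation n)%g l.+1 = chain (push x (s^-1%g ord_max)) s l.
Proof.
move=> ln; apply/funext => c; rewrite /chain /push permM /rotation -addnA.
congr (_ + _)%N; have -> : (c == s^-1%g ord_max) = (s c == ord_max).
  by apply/eqP/eqP => [->|<-]; rewrite ?permKV ?permK.
case: (unliftP ord_max (s c)) => [c'|] ->.
  by rewrite lift_perm_lift perm1 eq_sym (negbTE (neq_lift _ _)) lift0 lift_max.
rewrite lift_perm_id eqxx /= (_ : (n < l)%N = false)//; lia.
Qed.

(** The contribution of the face of the path omitting its final vertex. *)
Definition face_term n (a : 'I_n.+1 -> ('I_n.+1 -> nat) -> int) (s : 'S_n.+1)
    (y : 'I_n.+1 -> nat) : int :=
  (\prod_(i < n) (a (lift ord_max i) (chain y s i.+1)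
                  - a (lift ord_max i) (chain y s i)))
  * a ord_max (chain y s n).

(** Discrete counterpart of the fact that a Jacobian determinant is a divergence:
split the increment of the last function into its two values, and move the one at
the endpoint to the initial face by sum_mixed_term_all and a rotation.  The sign
of the rotation compensates the sign produced by the n exchanges. *)
Lemma discrete_jacobian_divergence n a (x : 'I_n.+1 -> nat) :
  discrete_jacobian a x = \sum_(s : 'S_n.+1) (-1) ^+ s *
    (face_term a s (push x (s^-1%g ord_max)) - face_term a s x).
Proof.
under [RHS]eq_bigr do rewrite mulrBr.
rewrite [RHS]big_split /= sumrN.
have -> : \sum_(s : 'S_n.+1) (-1) ^+ s * face_term a s (push x (s^-1%g ord_max)) =
   \sum_(s : 'S_n.+1) (-1) ^+ s * mixed_term a (chain x s) n.
  rewrite sum_mixed_term_all [in RHS](reindex_inj (mulIg (rotation n))) mulr_sumr.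
  apply: eq_bigr => s _; rewrite mulrA -(signr_odd _ n) -signr_addb.
  rewrite odd_permM odd_lift_perm odd_perm1 /= addbF addbF addbC addbK.
  congr (_ * _); rewrite /face_term /mixed_term chain_rotation//; congr (_ * _).
  by apply: eq_bigr => i _; rewrite addn1 !chain_rotation// ltnW.
rewrite -sumrB; apply: eq_bigr => s _; rewrite -mulrBr; congr (_ * _).
have wE (i : 'I_n) : widen_ord (leqnSn n) i = lift ord_max i.
  by apply: val_inj; rewrite /= /bump leqNgt ltn_ord.
rewrite big_ord_recr /= mulrBr; congr (_ * _ - _ * _).
  by apply: eq_bigr => i _; rewrite wE leqNgt ltn_ord addn0.
by apply: eq_bigr => i _; rewrite wE.
Qed.

(** The sum telescopes along every grid line in direction k. *)
Lemma sum_push n N (k : 'I_n.+1) (h : ('I_n.+1 -> nat) -> int) :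
  \sum_(x : {ffun 'I_n.+1 -> 'I_N}) (h (push (fun c => x c) k) - h (fun c => x c)) =
  \sum_(y : {ffun 'I_n -> 'I_N}) 
    (h (extend k N (fun c => y c)) - h (extend k 0 (fun c => y c))).
Proof.
pose f (p : {ffun 'I_n -> 'I_N} * 'I_N) : {ffun 'I_n.+1 -> 'I_N} :=
  [ffun c => if unlift k c is Some c' then p.1 c' else p.2].
pose g (x : {ffun 'I_n.+1 -> 'I_N}) : {ffun 'I_n -> 'I_N} * 'I_N :=
  ([ffun c => x (lift k c)], x k).
rewrite (reindex f) /=; last first.
  exists g => [[y v] _|x _].
    rewrite /g /f /=; congr pair; last by rewrite ffunE unlift_none.
    by apply/ffunP => c; rewrite !ffunE liftK.
  by apply/ffunP => c; rewrite !ffunE; case: unliftP => [c'|] -> //=; rewrite ffunE.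
rewrite -(pair_bigA _ (fun y v => h (push (fun c => f (y, v) c) k)
                                - h (fun c => f (y, v) c))) /=.
apply: eq_bigr => y _.
pose hk v := h (extend k v (fun c => y c)).
rewrite (eq_bigr (fun v : 'I_N => hk v.+1 - hk v)).
  rewrite -(big_mkord xpredT (fun v => hk v.+1 - hk v)).
  by rewrite telescope_sumr.
move=> v _; congr (h _ - h _); apply/funext => c; rewrite /push /extend /f ffunE /=.
  case: unliftP => [c'|] ->; last by rewrite eqxx addn1.
  by rewrite eq_sym (negbTE (neq_lift _ _)) addn0.
by case: unliftP.
Qed.

(** Until its last step, the path of s keeps its k-th coordinate, k being the
direction of that step.  If the path lies in a face of the grid on which a_k is
constant then the k-th increment vanishes; for k = ord_max it is the final value
that vanishes. *)
Lemma face_term_eq0 n N (a : 'I_n.+1 -> ('I_n.+1 -> nat) -> int) (s : 'S_n.+1)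
    (y : 'I_n.+1 -> nat) :
  (forall i x, x i = 0%N -> a i x = 0) -> (forall i x, x i = N -> a i x = 1) ->
  let k := s^-1%g ord_max in
  y k = 0%N \/ (y k = N /\ k != ord_max) -> face_term a s y = 0.
Proof.
move=> a0 a1 k yk.
have chaink l : (l <= n)%N -> chain y s l k = y k.
  by move=> ln; rewrite /chain /k permKV /= ltnNge ln addn0.
have [kmax|knmax] := eqVneq k ord_max.
  case: yk => [yk|[_ /eqP//]]; 
    rewrite /face_term a0 ?mulr0// -kmax chaink//; exact: yk.
move: (knmax); rewrite eq_sym => /unlift_some[i ki _].
rewrite /face_term (bigD1 i)//= -ki.
have [b Hb] : exists b, forall l, (l <= n)%N -> a k (chain y s l) = b.
  case: yk => [yk|[yk _]]; [exists 0|exists 1] => l ln.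
    by rewrite a0// chaink.
  by rewrite a1// chaink.
by rewrite !Hb ?subrr ?mul0r// ltnW.
Qed.

(** By the divergence formula the sum telescopes to boundary faces.  On all of
them some factor vanishes, except on the face x_max = N, where a_max = 1 and the
remaining factors are the discrete Jacobian in one dimension less. *)
Lemma sum_discrete_jacobian n N (a : 'I_n -> ('I_n -> nat) -> int) :
  (forall i x, x i = 0%N -> a i x = 0) -> (forall i x, x i = N -> a i x = 1) ->
  \sum_(x : {ffun 'I_n -> 'I_N}) discrete_jacobian a (fun c => x c) = 1.
Proof.
elim: n a => [|n IH] a a0 a1.
  rewrite (eq_bigr (fun=> 1)) => [|x _]; last first.
    rewrite /discrete_jacobian (eq_bigr (fun=> 1)).
      by rewrite sumr_const -[#|_|]/(#|'S_0|) card_Sn.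
    move=> s _; rewrite big_ord0 mulr1 (_ : s = 1%g) ?odd_perm1//.
    by apply/permP => -[].
  by rewrite sumr_const card_ffun !card_ord expn0.
under eq_bigr do rewrite discrete_jacobian_divergence.
rewrite exchange_big /=.
under eq_bigr do rewrite -mulr_sumr sum_push.
pose a' (i : 'I_n) (y : 'I_n -> nat) := a (lift ord_max i) (extend ord_max N y).
rewrite -[RHS](IH a'); last first.
- by move=> i x xi; rewrite /a' a1// /extend liftK.
- by move=> i x xi; rewrite /a' a0// /extend liftK.
rewrite /discrete_jacobian [RHS]exchange_big /=.
(* Only the faces orthogonal to the last direction contribute. *)
rewrite (bigID (fun s : 'S_n.+1 => s ord_max == ord_max)) /= [X in _ + X]big1 ?addr0.
  rewrite (reindex (lift_perm ord_max ord_max)) /=; last first.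
    (* Permutations fixing ord_max are the lifts of permutations of 'I_n. *)
    pose f (s : 'S_n.+1) c := odflt c (unlift ord_max (s (lift ord_max c))).
    have fE (s : 'S_n.+1) c : s ord_max = ord_max ->
        lift ord_max (f s c) = s (lift ord_max c).
      move=> sm; rewrite /f; case: unliftP => [//|] sc; move: sc.
      by rewrite -{2}sm => /perm_inj /eqP; rewrite eq_sym (negbTE (neq_lift _ _)).
    exists (fun s => odflt 1%g [pick s' | lift_perm ord_max ord_max s' == s]).
      move=> s' _; case: pickP => [s'' /eqP e /=|/(_ s')]; last by rewrite eqxx.
      apply/permP => c; apply: (@lift_inj _ ord_max).
      by rewrite -!(lift_perm_lift ord_max) e.
    move=> s /eqP sm; case: pickP => [s' /eqP //|].
    have f_inj : injective (f s).
      by move=> c d /(congr1 (lift ord_max)); rewrite !fE// => /perm_inj/lift_inj.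
    move=> /(_ (perm f_inj)) /eqP[]; apply/permP => c.
    case: (unliftP ord_max c) => [c'|] ->; last by rewrite lift_perm_id.
    by rewrite lift_perm_lift permE fE.
  apply: eq_big => [s|s _]; first by rewrite lift_perm_id eqxx.
  rewrite lift_permV lift_perm_id odd_lift_perm addbb addFb mulr_sumr.
  apply: eq_bigr => x _; congr (_ * _).
  rewrite [X in _ - X](face_term_eq0 a0 a1) ?subr0; last first.
    by left; rewrite /extend lift_permV lift_perm_id unlift_none.
  have chainE l : (l <= n)%N ->
     chain (extend ord_max N (fun c => x c)) (lift_perm ord_max ord_max s) l
      = extend ord_max N (chain (fun c => x c) s l).
    move=> ln; apply/funext => c; rewrite /chain /extend.
    case: unliftP => [c'|] ->; first by rewrite lift_perm_lift lift_max.
    by rewrite lift_perm_id /= ltnNge ln addn0.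
  rewrite /face_term a1 ?mulr1; last by rewrite chainE// /extend unlift_none.
  by apply: eq_bigr => i _; rewrite !chainE// ltnW.
move=> s /eqP sm; rewrite big1 ?mulr0// => x _.
have km : s^-1%g ord_max != ord_max.
  by apply/eqP => km; apply: sm; rewrite -{1}km permKV.
rewrite !(face_term_eq0 a0 a1) ?subrr//.
  by left; rewrite /extend unlift_none.
by right; rewrite /extend unlift_none.
Qed.

(** A sum equal to 1 has a nonzero term, that is, a lattice path along which every
a_i changes its value. *)
Lemma exists_rainbow_cube n N (a : 'I_n -> ('I_n -> nat) -> bool) :
  (forall i x, x i = 0%N -> ~~ a i x) -> (forall i x, x i = N -> a i x) ->
  exists x : {ffun 'I_n -> 'I_N}, forall i,
    exists u v : 'I_n -> nat, [/\ a i u, ~~ a i v &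
      forall c, (x c <= u c <= x c + 1)%N /\ (x c <= v c <= x c + 1)%N].
Proof.
move=> a0 a1; pose b i (x : 'I_n -> nat) : int := (a i x)%:Z.
have := @sum_discrete_jacobian n N b.
have b0 i x : x i = 0%N -> b i x = 0 by move=> /a0; rewrite /b; case: (a i x).
have b1 i x : x i = N -> b i x = 1 by move=> /a1; rewrite /b => ->.
move=> /(_ b0 b1) S1.
have [x] : exists x : {ffun 'I_n -> 'I_N}, discrete_jacobian b (fun c => x c) != 0.
  apply/existsP; apply: contraT; rewrite negb_exists => /forallP H.
  by move: S1; rewrite big1 => // x _; apply/eqP; have := H x; rewrite negbK.
pose P (s : 'S_n) := \prod_(i < n) (b i (chain (fun c => x c) s i.+1)
                                    - b i (chain (fun c => x c) s i)).
move=> jx; have [s Ps] : exists s, P s != 0.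
  apply/existsP; apply: contraNT jx; rewrite negb_exists => /forallP H.
  rewrite /discrete_jacobian big1// => s _.
  by have := H s; rewrite negbK /P => /eqP ->; rewrite mulr0.
exists x => i; move: Ps; rewrite /P => /prodf_neq0/(_ i isT).
have chainE l c : (x c <= chain (fun c => x c) s l c <= x c + 1)%N.
  by rewrite /chain leq_addr leq_add2l leq_b1.
rewrite /b; set u := chain _ _ _; set v := chain _ _ _.
case au : (a i u); case av : (a i v) => // _.
  by exists u, v; rewrite au av; split=> // c; split; exact: chainE.
by exists v, u; rewrite au av; split=> // c; split; exact: chainE.
Qed.

(** * The Poincare-Miranda and Brouwer theorems *)

Lemma cvg_mx (R : realType) (T : Type) m n (F : set_system T) (FF : Filter F)
    (f : T -> 'M[R]_(m, n)) (M : 'M[R]_(m, n)) :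
  (forall i j, (fun t => f t i j) @ F --> M i j) -> f @ F --> M.
Proof.
move=> fM A [P nP PA]; rewrite /nbhs /=.
have H := @filter_forall T ('I_m * 'I_n)%type
  (fun ij => [set t | P ij.1 ij.2 (f t ij.1 ij.2)]) F FF
  (fun ij => fM ij.1 ij.2 _ (nP ij.1 ij.2)).
by apply: filterS H => t Ht; apply: PA => i j; exact: (Ht (i, j)).
Qed.

Section pointwise_continuity.
Variables (R : realType) (T : topologicalType) (x : T).

Lemma for_continuous_mx m n (f : T -> 'M[R]_(m, n)) :
  (forall i j, {for x, continuous (fun t => f t i j)}) -> {for x, continuous f}.
Proof. by move=> cf; apply: cvg_mx => i j; exact: cf. Qed.

Lemma for_continuous_coord m n (f : T -> 'M[R]_(m, n)) i j :
  {for x, continuous f} -> {for x, continuous (fun t => f t i j)}.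
Proof.
by move=> cf; apply: (@continuous_comp _ _ _ f (fun M : 'M[R]_(m, n) => M i j));
  [|exact: coord_continuous].
Qed.

Lemma for_continuousD (V : normedModType R) (f g : T -> V) :
  {for x, continuous f} -> {for x, continuous g} ->
  {for x, continuous (fun t => f t + g t)}.
Proof. exact: continuousD. Qed.

Lemma for_continuousB (V : normedModType R) (f g : T -> V) :
  {for x, continuous f} -> {for x, continuous g} ->
  {for x, continuous (fun t => f t - g t)}.
Proof. exact: continuousB. Qed.

Lemma for_continuousM (f g : T -> R) :
  {for x, continuous f} -> {for x, continuous g} ->
  {for x, continuous (fun t => f t * g t)}.
Proof. exact: continuousM. Qed.

Lemma for_continuous_sum (I : Type) (r : seq I) (F : I -> T -> R) :
  (forall i, {for x, continuous (F i)}) ->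
  {for x, continuous (fun t => \sum_(i <- r) F i t)}.
Proof.
move=> cF; elim: r => [|i r IH].
  under [X in {for x, continuous X}]funext => t do rewrite big_nil.
  exact: cst_continuous.
under [X in {for x, continuous X}]funext => t do rewrite big_cons.
exact: for_continuousD.
Qed.

Lemma for_continuous_mulmx m n p (f : T -> 'M[R]_(m, n)) (g : T -> 'M[R]_(n, p)) :
  {for x, continuous f} -> {for x, continuous g} ->
  {for x, continuous (fun t => f t *m g t)}.
Proof.
move=> cf cg; apply: for_continuous_mx => i j.
under [X in {for x, continuous X}]funext => t do rewrite mxE.
by apply: for_continuous_sum => k; apply: for_continuousM;
  exact: for_continuous_coord.
Qed.

End pointwise_continuity.

Lemma coord_le_norm (R : realType) m n (x : 'M[R]_(m, n)) i j : `|x i j| <= `|x|.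
Proof.
by rewrite [leRHS]/Num.Def.normr /= mx_normrE; apply/bigmax_geP; right; exists (i, j).
Qed.

Lemma mx_norm_leP (R : realType) m n (x : 'M[R]_(m, n)) (b : R) : 0 <= b ->
  (forall i j, `|x i j| <= b) -> `|x| <= b.
Proof.
move=> b0 xb; rewrite [leLHS]/Num.Def.normr /= mx_normrE; apply/bigmax_leP.
by split=> // -[i j] _; exact: xb.
Qed.

(** Label a grid of mesh 1/(k+1) by the signs of the components of f.  Some grid
cube sees both signs of every component, and a cluster point of such cubes as k
grows is a zero. *)
Lemma poincare_miranda (R : realType) m (f : 'rV[R]_m -> 'rV[R]_m) :
  continuous f ->
  (forall (x : 'rV[R]_m) i, x 0 i = 0 -> f x 0 i <= 0) ->
  (forall (x : 'rV[R]_m) i, x 0 i = 1 -> 0 <= f x 0 i) ->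
  exists x, f x = 0.
Proof.
move=> cf f0 f1.
pose pt k (u : 'I_m -> nat) : 'rV[R]_m := \row_c ((u c)%:R / k.+1%:R).
(* The boundary hypotheses are weak inequalities, so the labels on the two faces
   are prescribed rather than read off from the sign. *)
pose a k i (u : 'I_m -> nat) :=
  (u i == k.+1) || (u i != 0%N) && (0 < f (pt k u) 0 i).
have near_zero k : exists x : 'rV[R]_m, (forall i, 0 <= x 0 i <= 1) /\
   forall i, exists y z : 'rV[R]_m, [/\ 0 <= f y 0 i, f z 0 i <= 0,
     `|x - y| <= k.+1%:R^-1 & `|x - z| <= k.+1%:R^-1].
  have [] := @exists_rainbow_cube m k.+1 (a k).
  - by move=> i x xi; rewrite /a xi.
  - by move=> i x xi; rewrite /a xi eqxx.
  move=> x Hx; exists (pt k (fun c => x c)); split.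
    move=> i; rewrite mxE divr_ge0 ?ler0n//= ler_pdivrMr ?ltr0n// mul1r ler_nat.
    exact: ltnW.
  have dist (u : 'I_m -> nat) : (forall c, (x c <= u c <= x c + 1)%N) ->
      `|pt k (fun c => x c) - pt k u| <= k.+1%:R^-1.
    move=> xu; apply: mx_norm_leP => [|i c]; first by rewrite invr_ge0.
    rewrite !mxE -mulrBl normrM [X in _ * X]ger0_norm ?invr_ge0 ?ler0n//.
    rewrite ler_piMl ?invr_ge0 ?ler0n//.
    have /andP[xu1 xu2] := xu c.
    by rewrite distrC ger0_norm ?subr_ge0 ?ler_nat// lerBlDl natr1 ler_nat -addn1.
  move=> i; have [u [v [au av uv]]] := Hx i.
  exists (pt k u), (pt k v); split.
  - case/orP: au => [/eqP uk|/andP[_ /ltW//]]; apply: f1.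
    by rewrite mxE uk divff// pnatr_eq0.
  - move: av; rewrite negb_or negb_and negbK -leNgt => /andP[_ /orP[/eqP v0|//]].
    by apply: f0; rewrite mxE v0 mul0r.
  - by apply: dist => c; have [] := uv c.
  - by apply: dist => c; have [] := uv c.
have {near_zero}[X HX] := choice near_zero.
have [p [_ pX]] : [set v : 'rV[R]_m | forall i, v 0 i \in `[0, 1]]
    `&` cluster (X @ \oo) !=set0.
  have cpt : compact [set v : 'rV[R]_m | forall i, v 0 i \in `[0, 1]].
    have := @rV_compact R m (fun=> [set` `[0 : R, 1]]) (fun=> @segment_compact R 0 1).
    by [].
  apply: cpt; exists 0%N => // k _ i; rewrite in_itv /=; exact: (HX k).1.
exists p; apply/rowP => i; rewrite mxE; apply/eqP.
have cfi : (fun y => f y 0 i) @ p --> f p 0 i.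
  apply: (@cvg_comp _ _ _ f (fun v : 'rV[R]_m => v 0 i)); first exact: cf.
  exact: coord_continuous.
have close (B : set R) : nbhs (f p 0 i) B -> exists y z : 'rV[R]_m,
    [/\ 0 <= f y 0 i, f z 0 i <= 0, B (f y 0 i) & B (f z 0 i)].
  move=> /cfi /nbhs_ballP[e /= e0 eB].
  have [K HK] : exists K : nat, forall k, (K <= k)%N -> k.+1%:R^-1 < e / 2 :> R.
    have := @near_infty_natSinv_lt R (PosNum (divr_gt0 e0 (ltr0Sn _ 1))).
    by move=> [K _ HK]; exists K.
  have [] := pX (X @` [set k | (K <= k)%N]) (ball p (e / 2)).
  - by exists K => // k Kk; exists k.
  - by apply: nbhsx_ballx; rewrite divr_gt0.
  move=> _ [[k Kk <-]]; rewrite -ball_normE /= => pXk.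
  have [_ /(_ i)[y [z [fy fz Xy Xz]]]] := HX k.
  have near_p w : `|X k - w| <= k.+1%:R^-1 -> ball p e w.
    move=> Xw; rewrite -ball_normE /= -(subrKA (X k)).
    rewrite (le_lt_trans (ler_normD _ _))// (splitr e) ltrD//.
    exact: le_lt_trans Xw (HK _ Kk).
  by exists y, z; split=> //; apply: eB; apply: near_p.
case: (ltgtP (f p 0 i) 0) => // fp.
- have [y [_ [fy _ + _]]] := close _ (lt_nbhsl fp).
  by rewrite /= ltNge fy.
- have [_ [z [_ fz _ +]]] := close _ (lt_nbhsr fp).
  by rewrite /= ltNge fz.
Qed.

(** For a bounded g, the components of x - g x have the signs required by the
Poincare-Miranda theorem on the faces of a large cube. *)
Lemma brouwer_bounded (R : realType) m (g : 'rV[R]_m -> 'rV[R]_m) (b : R) :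
  continuous g -> (forall x, `|g x| <= b) -> exists x, g x = x.
Proof.
move=> cg gb.
have b1 : 0 < `|b| + 1 by rewrite ltr_wpDl.
pose h (x : 'rV[R]_m) : 'rV[R]_m := (2 * (`|b| + 1)) *: x - const_mx (`|b| + 1).
have ch : continuous h.
  move=> x; apply: for_continuousB; last exact: cst_continuous.
  by apply: continuousZ; [exact: cst_continuous|exact: cvg_id].
have gbi x i : `|g x 0 i| <= `|b| + 1.
  apply: le_trans (coord_le_norm _ _ _) _; apply: le_trans (gb x) _.
  by rewrite (le_trans (ler_norm b))// lerDl.
have [|x i xi|x i xi|x Hx] := @poincare_miranda R m (fun x => h x - g (h x)).
- move=> x; apply: for_continuousB; first exact: ch.
  by apply: continuous_comp; [exact: ch|exact: cg].
- rewrite !mxE xi.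
  by have := gbi (h x) i; rewrite ler_norml => /andP[? ?]; lra.
- rewrite !mxE xi.
  by have := gbi (h x) i; rewrite ler_norml => /andP[? ?]; lra.
- by exists (h x); apply/esym/eqP; rewrite -subr_eq0 Hx.
Qed.

(** * Nowhere zero sections over a ball *)

Lemma mulmx_norm_le (R : realType) n p (u : 'rV[R]_n) (D : 'M[R]_(n, p)) :
  `|u *m D| <= n%:R * `|u| * `|D|.
Proof.
apply: mx_norm_leP => [|i j]; first by rewrite !mulr_ge0.
rewrite mxE; apply: le_trans (ler_norm_sum _ _ _) _.
apply: (@le_trans _ _ (\sum_(k < n) `|u| * `|D|)).
  by apply: ler_sum => k _; rewrite normrM ler_pM// coord_le_norm.
by rewrite sumr_const card_ord -mulrA mulr_natl.
Qed.

Lemma uniform_continuity_on_ball (R : realType) m n p (K : 'rV[R]_m -> 'M[R]_(n, p))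
    (r e : R) : continuous K -> 0 <= r -> 0 < e ->
  exists k : nat, forall y y', `|y| <= r -> `|y - y'| <= r / k.+1%:R ->
    `|K y - K y'| < e.
Proof.
move=> cK r0 e0.
have : compact [set y : 'rV[R]_m | `|y| <= r].
  apply: bounded_closed_compact.
    exists r; split; first exact: ger0_real.
    by move=> x rx y /= /le_trans; apply; exact: ltW.
  rewrite (_ : [set _ | _] = (fun y : 'rV[R]_m => `|y|) @^-1` [set x | x <= r])//.
  by apply: closed_comp; [move=> x _; exact: norm_continuous|exact: closed_le].
move=> /compact_near_coveringP nc.
pose P (k : nat) (y : 'rV[R]_m) :=
  forall y', `|y - y'| <= r / k.+1%:R -> `|K y - K y'| < e.
suff H : forall x, `|x| <= r -> \forall x' \near x & k \near \oo, P k x'.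
  have [k _ Hk] := nc nat \oo P _ H.
  by exists k => y y' yr; apply: Hk => //=.
move=> x _.
have e2 : 0 < e / 2 by rewrite divr_gt0.
have /cvgrPdist_lt/(_ _ e2)/nbhs_ballP[d /= d0 dK] := cK x.
have d2 : 0 < d / 2 by rewrite divr_gt0.
have [k0 _ Hk0] : \forall k \near \oo, r / k.+1%:R < d / 2.
  have := @near_infty_natSinv_lt R (PosNum (divr_gt0 d2 (ltr_wpDl r0 (@ltr01 R)))).
  apply: filterS => k /= Hk.
  have r1 : 0 < r + 1 by rewrite ltr_wpDl.
  move: Hk; rewrite ltr_pdivlMr// => Hk; apply: le_lt_trans Hk.
  by rewrite mulrC ler_wpM2l// lerDl.
exists (ball x (d / 2), [set k | (k0 <= k)%N]).
  by split; [exact: nbhsx_ballx|exists k0].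
move=> [y k] [/= xy k0k] y' yy'.
have xy' : ball x d y'.
  move: xy; rewrite -ball_normE /= => xy; rewrite -(subrKA y).
  rewrite (le_lt_trans (ler_normD _ _))// (splitr d) ltrD//.
  exact: le_lt_trans yy' (Hk0 _ k0k).
have xyd : ball x d y by apply: le_ball xy; rewrite ler_pdivrMr// ler_peMr ?ltW// ltr1n.
rewrite -(subrKA (K x)) (le_lt_trans (ler_normD _ _))// (splitr e) ltrD//.
  by rewrite distrC; exact: dK.
exact: dK.
Qed.

(** A vector bundle over a ball is trivial along rays.  Start from a nonzero vector
in the fibre at 0 and project it successively to the fibres over the points
(j / N) y; by uniform continuity consecutive projections are so close that
none of these steps can kill the vector. *)
Lemma exists_section (R : realType) m n (K : 'rV[R]_m -> 'M[R]_n) (r : R) :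
  0 <= r -> continuous K -> (forall y, K y *m K y = K y) -> K 0 != 0 ->
  exists2 v : 'rV[R]_m -> 'rV[R]_n, continuous v &
    forall y, `|y| <= r -> v y *m K y = v y /\ v y != 0.
Proof.
move=> r0 cK KK K0.
have e0 : (0 : R) < n.+1%:R^-1 by rewrite invr_gt0.
have [N HN] := uniform_continuity_on_ball cK r0 e0.
have [i0 i0P] : exists i, row i (K 0) != 0.
  apply/existsP; apply: contraNT K0; rewrite negb_exists => /forallP H.
  by apply/eqP/row_matrixP => i; have := H i; rewrite negbK => /eqP ->; rewrite row0.
pose pt j (y : 'rV[R]_m) := (j%:R / N.+1%:R) *: y.
pose v := fix v j (y : 'rV[R]_m) : 'rV[R]_n :=
  if j is j'.+1 then v j' y *m K (pt j y) else row i0 (K 0).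
have cpt j : continuous (pt j).
  move=> y; apply: (@continuousZ _ _ _ (fun=> j%:R / N.+1%:R) id y).
    exact: cst_continuous.
  exact: cvg_id.
exists (v N.+1).
  elim: N.+1 => [|j IH] y /=; first exact: cst_continuous.
  apply: for_continuous_mulmx; first exact: IH.
  by apply: continuous_comp; [exact: cpt|exact: cK].
move=> y yr.
suff H j : (j <= N.+1)%N -> v j y *m K (pt j y) = v j y /\ v j y != 0.
  by have [] := H N.+1 (leqnn _); rewrite /pt divff ?pnatr_eq0// scale1r.
elim: j => [|j IH] jN.
  by rewrite /= /pt mul0r scale0r -row_mul KK.
have [vK v0] := IH (ltnW jN).
split; first by rewrite /= -mulmxA KK.
apply/eqP => /= vj; move: v0; apply/negP; rewrite negbK.
have : v j y = v j y *m (K (pt j y) - K (pt j.+1 y)) by rewrite mulmxBr vj subr0.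
move=> /(congr1 Num.norm) vE; rewrite -normr_eq0 eq_le normr_ge0 andbT leNgt.
apply/negP => v0; have := mulmx_norm_le (v j y) (K (pt j y) - K (pt j.+1 y)).
have K_lt : `|K (pt j y) - K (pt j.+1 y)| < n.+1%:R^-1.
  apply: HN.
    rewrite normrZ ger0_norm ?divr_ge0//; apply: le_trans yr.
    by rewrite ler_piMl// ler_pdivrMr// mul1r ler_nat ltnW.
  rewrite -scalerBl -mulrBl normrZ -natr1 opprD addrA subrr sub0r normrM normrN1.
  by rewrite mul1r ger0_norm ?invr_ge0// mulrC ler_wpM2r// invr_ge0.
rewrite -vE leNgt => /negP; apply.
rewrite mulrAC gtr_pMl//.
apply: (@le_lt_trans _ _ (n%:R / n.+1%:R)); first by rewrite ler_wpM2l// ltW.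
by rewrite ltr_pdivrMr// mul1r ltr_nat.
Qed.

(** * Euclidean geometry and the projection onto a line *)

Section dot.
Variables (R : realType) (m : nat).
Implicit Types u v w : 'rV[R]_m.

Definition dot u v : R := \sum_i u 0 i * v 0 i.

Lemma dotC u v : dot u v = dot v u.
Proof. by apply: eq_bigr => i _; rewrite mulrC. Qed.

Lemma dotDl u v w : dot (u + v) w = dot u w + dot v w.
Proof. by rewrite -big_split; apply: eq_bigr => i _; rewrite mxE mulrDl. Qed.

Lemma dotZl a u w : dot (a *: u) w = a * dot u w.
Proof. by rewrite mulr_sumr; apply: eq_bigr => i _; rewrite mxE mulrA. Qed.

Lemma dotNl u w : dot (- u) w = - dot u w.
Proof. by rewrite -scaleN1r dotZl mulN1r. Qed.

Lemma dotDr u v w : dot w (u + v) = dot w u + dot w v.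
Proof. by rewrite dotC dotDl !(dotC w). Qed.

Lemma dotZr a u w : dot w (a *: u) = a * dot w u.
Proof. by rewrite dotC dotZl (dotC w). Qed.

Lemma dotNr u w : dot w (- u) = - dot w u.
Proof. by rewrite dotC dotNl dotC. Qed.

Lemma dot_ge0 u : 0 <= dot u u.
Proof. by apply: sumr_ge0 => i _; rewrite -expr2 sqr_ge0. Qed.

Lemma dot_eq0 u : (dot u u == 0) = (u == 0).
Proof.
apply/idP/eqP => [|->]; last by rewrite /dot big1// => i _; rewrite mxE mul0r.
rewrite psumr_eq0 => [/allP u0|i _]; last by rewrite -expr2 sqr_ge0.
apply/rowP => i; have := u0 i (mem_index_enum i).
by rewrite mxE /= mulf_eq0 orbb => /eqP.
Qed.

Lemma enorm_sqr u : enorm u ^+ 2 = dot u u.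
Proof.
rewrite /enorm sqr_sqrtr; last by apply: sumr_ge0 => i _; rewrite sqr_ge0.
by apply: eq_bigr => i _; rewrite expr2.
Qed.

Lemma enormE u : enorm u = Num.sqrt (dot u u).
Proof. by congr Num.sqrt; apply: eq_bigr => i _; rewrite expr2. Qed.

Lemma enorm_ge0 u : 0 <= enorm u.
Proof. exact: sqrtr_ge0. Qed.

Lemma enormZ a u : enorm (a *: u) = `|a| * enorm u.
Proof.
by rewrite !enormE dotZl dotZr mulrA -expr2 sqrtrM ?sqr_ge0// sqrtr_sqr.
Qed.

Lemma coord_le_enorm u i : `|u 0 i| <= enorm u.
Proof.
rewrite -sqrtr_sqr enormE ler_wsqrtr// /dot (bigD1 i)//= -expr2 lerDl.
by apply: sumr_ge0 => j _; rewrite -expr2 sqr_ge0.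
Qed.

Lemma for_continuous_dot (T : topologicalType) (x : T) (f g : T -> 'rV[R]_m) :
  {for x, continuous f} -> {for x, continuous g} ->
  {for x, continuous (fun t => dot (f t) (g t))}.
Proof.
move=> cf cg; apply: for_continuous_sum => i.
by apply: for_continuousM; exact: for_continuous_coord.
Qed.

Lemma for_continuous_enorm (T : topologicalType) (x : T) (f : T -> 'rV[R]_m) :
  {for x, continuous f} -> {for x, continuous (fun t => enorm (f t))}.
Proof.
move=> cf; under [X in {for x, continuous X}]funext => t do rewrite enormE.
apply: (@continuous_comp _ _ _ (fun t => dot (f t) (f t)) (@Num.sqrt R)).
  exact: for_continuous_dot.
exact: sqrt_continuous.
Qed.

End dot.

Section lines.
Variables (R : realType) (n : nat).

Lemma Gr1P (L : Gr1 R n) : exists (v : 'rV[R]_n.+1) (v0 : v != 0), L = span1 v0.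
Proof.
have L0 : vpick (val L) != 0.
  by rewrite vpick0; apply/eqP => L0; have := valP L; rewrite L0 dimv0.
exists (vpick (val L)), L0; apply: val_inj; apply/eqP; rewrite eq_sym /=.
by rewrite eqEdim -memvE memv_pick /= dim_vline L0 (eqP (valP L)).
Qed.

Definition vector_proj (v : 'rV[R]_n.+1) : 'M[R]_n.+1 :=
  (dot v v)^-1 *: (v^T *m v).

(** The orthogonal projection onto the line, acting on row vectors on the right.
It turns continuity into Gr1 into continuity of matrices. *)
Definition line_proj (L : Gr1 R n) : 'M[R]_n.+1 := vector_proj (vpick (val L)).

Lemma mul_vector_proj (u v : 'rV[R]_n.+1) :
  u *m vector_proj v = (dot u v / dot v v) *: v.
Proof.
rewrite /vector_proj -scalemxAr mulmxA [u *m _]mx11_scalar mul_scalar_mx scalerA.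
congr (_ *: _); rewrite mulrC; congr (_ / _); rewrite mxE.
by apply: eq_bigr => i _; rewrite mxE.
Qed.

Lemma vector_projZ a (v : 'rV[R]_n.+1) : a != 0 ->
  vector_proj (a *: v) = vector_proj v.
Proof.
move=> a0; apply/matrixP => i j; rewrite !mxE !big_ord1 !mxE dotZl dotZr !invfM.
by set d := (dot v v)^-1; field.
Qed.

Lemma line_proj_span1 (v : 'rV[R]_n.+1) (v0 : v != 0) :
  line_proj (span1 v0) = vector_proj v.
Proof.
rewrite /line_proj /=; have /vlineP[a Ha] := memv_pick <[v]>%VS.
rewrite Ha vector_projZ//; apply: contraTneq v0 => a0.
by move/eqP: Ha; rewrite a0 scale0r vpick0 -dimv_eq0 dim_vline; case: (v == 0).
Qed.

Lemma mem_lineP (L : Gr1 R n) u : u \in val L <-> u *m line_proj L = u.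
Proof.
have [v [v0 ->]] := Gr1P L; rewrite line_proj_span1 mul_vector_proj /=; split.
  move=> /vlineP[a ->]; rewrite dotZl mulfK//.
  by rewrite dot_eq0.
by move=> <-; apply/vlineP; eexists.
Qed.

Lemma line_proj_idem (L : Gr1 R n) : line_proj L *m line_proj L = line_proj L.
Proof.
have [v [v0 ->]] := Gr1P L; rewrite line_proj_span1.
rewrite {1}/vector_proj -scalemxAl -mulmxA mul_vector_proj divff ?dot_eq0//.
by rewrite scale1r.
Qed.

Lemma line_proj_neq0 (L : Gr1 R n) : line_proj L != 0.
Proof.
have [v [v0 ->]] := Gr1P L; rewrite line_proj_span1.
apply: contra_neq v0 => p0; have := mul_vector_proj v v.
have [->//|v0] := eqVneq v 0.
by rewrite p0 mulmx0 divff ?dot_eq0// scale1r.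
Qed.

(** Gr1 has the quotient topology, so it suffices that the projection onto the
line spanned by v is continuous in v away from 0. *)
Lemma line_proj_continuous : continuous line_proj.
Proof.
apply/continuousP => W oW.
rewrite /open /= /Gr1_open /=.
rewrite (_ : [set v | _] = [set v | v != 0 /\ W (vector_proj v)]); last first.
  apply/seteqP; split=> v /= [v0]; rewrite ?line_proj_span1 => Wv; first by [].
  by exists v0; rewrite line_proj_span1.
rewrite openE => v [/= v0 Wv].
have cv : {for v, continuous vector_proj}.
  apply: continuousZ.
    apply: continuousV; first by rewrite dot_eq0.
    by apply: for_continuous_dot; exact: cvg_id.
  apply: for_continuous_mulmx; last exact: cvg_id.
  apply: for_continuous_mx => i j.
  under [X in {for v, continuous X}]funext => t do rewrite mxE.
  by apply: for_continuous_coord; exact: cvg_id.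
apply: filterI; last by apply: cv; exact: open_nbhs_nbhs.
apply: open_nbhs_nbhs; split=> //.
rewrite (_ : (fun _ => _) = ~` [set 0]).
  exact/closed_openC/accessible_closed_set1/hausdorff_accessible/norm_hausdorff.
by apply/seteqP; split=> w /= /eqP.
Qed.

End lines.

Lemma for_continuous_within (T U V : topologicalType)
    (X : set U) (phi : U -> V) (h : T -> U) (x : T) :
  {within X, continuous phi} -> {for x, continuous h} ->
  (\forall t \near x, X (h t)) -> {for x, continuous (fun t => phi (h t))}.
Proof.
move=> /subspace_continuousP cphi ch Xh B nB.
have := cphi (h x) (nbhs_singleton Xh) B nB.
rewrite /within /= => /ch; rewrite /= => H.
by apply: filterS2 Xh H => t Xt; apply.
Qed.

(** * Lines transverse to the sphere *)

(** With L the derivative at p, a solution of G x = z is a fixed point of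
x - (G x - z) L^-1, which maps a small cube around p to itself as soon as z is
close to G p.  Precomposing with the retraction onto this cube puts the map in the
scope of the Brouwer theorem.  No regularity of G besides continuity is available
away from p, so the inverse function theorem would not apply. *)
Lemma invertible_derivative_open (R : realType) m (G : 'rV[R]_m -> 'rV[R]_m)
    (L : 'M[R]_m) (p : 'rV[R]_m) (O : set 'rV[R]_m) :
  nbhs p O -> (forall x, O x -> {for x, continuous G}) -> L \in unitmx ->
  (forall e : R, 0 < e ->
     \forall x \near p, `|G x - G p - (x - p) *m L| <= e * `|x - p|) ->
  nbhs (G p) (G @` O).
Proof.
move=> nO cG Lu dG.
(* c bounds the operator norm of the inverse of L for the sup norm. *)
pose c := m%:R * `|invmx L| + 1.
have c0 : 0 < c by rewrite ltr_wpDl// mulr_ge0.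
have cP (u : 'rV[R]_m) : `|u *m invmx L| <= c * `|u|.
  apply: le_trans (mulmx_norm_le _ _) _.
  by rewrite mulrAC ler_wpM2r// lerDl.
have e0 : 0 < (2 * c)^-1 by rewrite invr_gt0 mulr_gt0.
have nP : \forall x \near p, O x /\
    `|G x - G p - (x - p) *m L| <= (2 * c)^-1 * `|x - p|.
  by apply: filterI; [exact: nO|exact: dG].
have [d /= d0 dP] := (nbhs_ballP p _).1 nP.
pose r := d / 2.
have r0 : 0 < r by rewrite divr_gt0.
have rP x : `|x - p| <= r ->
    O x /\ `|G x - G p - (x - p) *m L| <= (2 * c)^-1 * `|x - p|.
  move=> xr; apply: dP; rewrite -ball_normE /= distrC (le_lt_trans xr)//.
  by rewrite ltr_pdivrMr// ltr_pMr// ltr1n.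
apply/nbhs_ballP; exists (r / (2 * c)); first by rewrite /= divr_gt0// mulr_gt0.
move=> z; rewrite -ball_normE /= distrC => zr.
pose clamp (x : 'rV[R]_m) : 'rV[R]_m :=
  \row_i (p 0 i + Num.max (- r) (Num.min r (x 0 i - p 0 i))).
have clamp_ball x : `|clamp x - p| <= r.
  apply: mx_norm_leP => [|i j]; first exact: ltW.
  rewrite ord1 !mxE addrAC subrr add0r ler_norml.
  by rewrite le_max lexx /= ge_max ge_min lexx andbT ge0_cp ?ltW.
have clamp_id x : `|x - p| <= r -> clamp x = x.
  move=> xr; apply/rowP => i; rewrite mxE.
  have := le_trans (coord_le_norm (x - p) 0 i) xr.
  rewrite !mxE ler_norml => /andP[x1 x2].
  by rewrite (min_idPr x2) (max_idPr x1); lra.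
have cclamp : continuous clamp.
  move=> x; apply: for_continuous_mx => i j.
  under [X in {for x, continuous X}]funext => t do rewrite mxE.
apply: (@for_continuousD R _ x R^o); first exact: cst_continuous.
  apply: (@continuous_max R _ (fun=> - r)); first exact: cst_continuous.
  apply: (@continuous_min R _ (fun=> r)); first exact: cst_continuous.
  apply: for_continuousB; last exact: cst_continuous.
  by apply: for_continuous_coord; exact: cvg_id.
pose g x := clamp x - (G (clamp x) - z) *m invmx L.
have gE x : g x - p = (z - G p) *m invmx L -
    (G (clamp x) - G p - (clamp x - p) *m L) *m invmx L.
  rewrite /g; move: (clamp x) => y.
  have -> : G y - z = (G y - G p - (y - p) *m L) + (y - p) *m L - (z - G p).
    by move: (_ *m L) => Y; apply/rowP => i; rewrite !mxE; ring.
  rewrite [in LHS]mulmxBl [in LHS]mulmxDl mulmxK//.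
  move: (_ *m _) (_ *m _) => X Y.
  apply/rowP => i; rewrite !mxE; ring.
have gr x : `|g x - p| <= r.
  rewrite gE; apply: le_trans (ler_normB _ _) _.
  have [_ H] := rP _ (clamp_ball x).
  rewrite (splitr r) lerD//; apply: le_trans (cP _) _.
    rewrite -ler_pdivlMl//; apply: le_trans (ltW zr) _.
    by rewrite (_ : c^-1 * _ = r / (2 * c))//; field; rewrite gt_eqF.
  rewrite -ler_pdivlMl//; apply: le_trans H _.
  rewrite (_ : c^-1 * _ = (2 * c)^-1 * r); last by field; rewrite gt_eqF.
  by rewrite ler_wpM2l ?invr_ge0 ?mulr_ge0// ltW.
have [x gx] : exists x, g x = x.
  apply: (@brouwer_bounded _ _ g (r + `|p|)).
    move=> x; apply: for_continuousB; first exact: cclamp.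
    apply: for_continuous_mulmx; last exact: cst_continuous.
    apply: for_continuousB; last exact: cst_continuous.
    apply: (@continuous_comp _ _ _ clamp G); first exact: cclamp.
    by apply: cG; have [] := rP _ (clamp_ball x).
  by move=> x; rewrite -(subrK p (g x)) (le_trans (ler_normD _ _))// lerD2r.
have xr : `|x - p| <= r by rewrite -gx.
exists x; first by have [] := rP _ xr.
have : (G x - z) *m invmx L = 0.
  by move: gx => /(congr1 (fun y => x - y)); rewrite /g clamp_id// subKr subrr.
move=> /(congr1 (mulmx^~ L)); rewrite mulmxKV// mul0mx => /eqP.
by rewrite subr_eq0 => /eqP.
Qed.

Section transversal.
Variables (R : realType) (m : nat).
Implicit Types (x p : 'rV[R]_m).

Definition normalize x : 'rV[R]_m := (enorm x)^-1 *: x.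

Lemma enorm_eq0 x : (enorm x == 0) = (x == 0).
Proof. by rewrite -dot_eq0 -enorm_sqr sqrf_eq0. Qed.

Lemma enorm_normalize x : x != 0 -> enorm (normalize x) = 1.
Proof.
move=> x0; rewrite enormZ ger0_norm ?invr_ge0 ?enorm_ge0// mulVf//.
by rewrite enorm_eq0.
Qed.

Lemma normalize_id p : enorm p = 1 -> normalize p = p.
Proof. by move=> p1; rewrite /normalize p1 invr1 scale1r. Qed.

Lemma normalize_continuous x : x != 0 -> {for x, continuous normalize}.
Proof.
move=> x0; apply: continuousZ; last exact: cvg_id.
apply: continuousV; first by rewrite enorm_eq0.
by apply: for_continuous_enorm; exact: cvg_id.
Qed.

Lemma dot_norm_le x p : `|dot x p| <= m%:R * `|x| * `|p|.
Proof.
apply: le_trans (ler_norm_sum _ _ _) _.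
apply: (@le_trans _ _ (\sum_(k < m) `|x| * `|p|)).
  by apply: ler_sum => k _; rewrite normrM ler_pM// coord_le_norm.
by rewrite sumr_const card_ord -mulrA mulr_natl.
Qed.

(** A vector u in the kernel is a multiple of v - p with coefficient - u.p;
pairing with p gives (u.p)(v.p) = 0. *)
Lemma transversal_unitmx p v : enorm p = 1 -> dot v p != 0 ->
  1%:M + p^T *m (v - p) \in unitmx.
Proof.
move=> p1 vp; rewrite -row_free_unit -kermx_eq0; apply/eqP/row_matrixP => i.
rewrite row0; set u := row i _.
have : u *m (1%:M + p^T *m (v - p)) = 0.
  by apply/eqP; rewrite -sub_kermx; exact: row_sub.
move: u => u.
rewrite mulmxDr mulmx1 mulmxA [u *m _]mx11_scalar mul_scalar_mx.
have -> : (u *m p^T) 0 0 = dot u p by rewrite mxE; apply: eq_bigr => j _; rewrite mxE.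
move=> uE; have := congr1 (fun y => dot y p) uE.
rewrite dotDl dotZl dotDl dotNl -(enorm_sqr p) p1 expr1n.
have -> : dot 0 p = 0 by rewrite /dot big1// => j _; rewrite mxE mul0r.
move=> H; have up : dot u p = 0.
  apply/eqP; have : dot u p * dot v p == 0 by apply/eqP; move: H; lra.
  by rewrite mulf_eq0 (negbTE vp) orbF.
by move: uE; rewrite up scale0r addr0.
Qed.

(** The map G x = x/|x| + (|x| - 1) w x fixes p.  With t = |x| - 1, its deviation
from the linear map u |-> u + (u.p)(w p - p) is
t ((w x - w p) - (x/|x| - p)) + ((|x - p|^2 - t^2) / 2) (w p - p),
where t = O(|x - p|), so it is o(|x - p|) by mere continuity of w. *)
Lemma transversal_lines_cover (w : 'rV[R]_m -> 'rV[R]_m) p (O : set 'rV[R]_m) :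
  enorm p = 1 -> nbhs p O -> (forall x, O x -> x != 0) ->
  (forall x, O x -> {for x, continuous w}) -> dot (w p) p != 0 ->
  nbhs p [set z | exists2 x, O x & exists t, z = normalize x + t *: w x].
Proof.
move=> p1 nO O0 cw wp.
pose G x := normalize x + (enorm x - 1) *: w x.
have Gp : G p = p by rewrite /G normalize_id// p1 subrr scale0r addr0.
suff : nbhs (G p) (G @` O).
  by rewrite Gp; apply: filterS => _ [x Ox <-]; exists x => //; eexists.
apply: (@invertible_derivative_open _ _ _ (1%:M + p^T *m (w p - p))) => //.
- move=> x Ox; apply: for_continuousD; first exact: normalize_continuous (O0 _ Ox).
  apply: continuousZ; last exact: cw.
  apply: for_continuousB; last exact: cst_continuous.
  by apply: for_continuous_enorm; exact: cvg_id.
- exact: transversal_unitmx.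
move=> e e0; rewrite Gp.
(* C is a Lipschitz constant of |x| at p for |x - p| <= 1; D collects the
   constants of the two terms of the deviation. *)
pose C := m%:R * (2 * `|p| + 1).
pose D := 2 * C + (m%:R + C ^+ 2) / 2 * `|w p - p|.
have C0 : 0 <= C by rewrite mulr_ge0// addr_ge0// mulr_ge0.
have D0 : 0 <= D by rewrite addr_ge0 ?mulr_ge0// addr_ge0// sqr_ge0.
pose d := Num.min 1 (e / (D + 1)).
have d0 : 0 < d by rewrite lt_min ltr01 divr_gt0// ltr_wpDl.
have dD : d * D <= e.
  apply: (@le_trans _ _ (e / (D + 1) * D)); first by rewrite ler_wpM2r// ge_min lexx orbT.
  by rewrite mulrAC ler_pdivrMr ?ltr_wpDl// ler_wpM2l ?lerDl// ltW.
have d1 : d <= 1 by rewrite ge_min lexx.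
have p0 : p != 0 by rewrite -enorm_eq0 p1 oner_eq0.
near=> x.
have xp : `|x - p| < d.
  by rewrite distrC; near: x; apply: cvgr_dist_lt => //; exact: cvg_id.
have wxp : `|w x - w p| < d.
  rewrite distrC; near: x; apply: cvgr_dist_lt => //; apply: cw.
  exact: nbhs_singleton nO.
have nxp : `|normalize x - p| < d.
  rewrite distrC; near: x; apply: cvgr_dist_lt => //.
  by move: (normalize_continuous p0); rewrite /prop_for /continuous_at (normalize_id p1).
have x0 : x != 0 by near: x; apply: filterS nO; exact: O0.
pose t := enorm x - 1.
have t_le : `|t| <= C * `|x - p|.
  have tE : t = dot (x - p) (x + p) / (enorm x + 1).
    rewrite dotDl dotNl !dotDr -!enorm_sqr p1 (dotC p x) /t.
    by field; rewrite gt_eqF// ltr_wpDl// enorm_ge0.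
  rewrite tE normrM normfV (@ger0_norm _ (enorm x + 1)) ?addr_ge0 ?enorm_ge0//.
  rewrite ler_pdivrMr ?ltr_wpDl ?enorm_ge0//.
  apply: le_trans (dot_norm_le _ _) _.
  apply: (@le_trans _ _ (C * `|x - p|)); last first.
    by rewrite ler_peMr ?mulr_ge0// lerDr enorm_ge0.
  rewrite /C mulrAC ler_wpM2r// ler_wpM2l//.
  have -> : x + p = (x - p) + 2 *: p by apply/rowP => i; rewrite !mxE; ring.
  apply: le_trans (ler_normD _ _) _; rewrite addrC normrZ ger0_norm// lerD2l.
  by rewrite (le_trans (ltW xp)).
pose q := dot (x - p) (x - p).
have q_le : `|q| <= m%:R * `|x - p| ^+ 2.
  by apply: le_trans (dot_norm_le _ _) _; rewrite expr2 mulrA.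
have dxp : dot (x - p) p = t - (q - t ^+ 2) / 2.
  rewrite /q /t dotDl dotNl [in RHS]dotDl !dotDr !dotNl !dotNr -!enorm_sqr p1.
  by rewrite (dotC p x); field.
have -> : G x - p - (x - p) *m (1%:M + p^T *m (w p - p)) =
   t *: ((w x - w p) - (normalize x - p)) + ((q - t ^+ 2) / 2) *: (w p - p).
  rewrite mulmxDr mulmx1 mulmxA [(x - p) *m _]mx11_scalar mul_scalar_mx.
  have -> : ((x - p) *m p^T) 0 0 = dot (x - p) p.
    by rewrite mxE; apply: eq_bigr => j _; rewrite [p^T _ _]mxE.
  rewrite dxp /G -/t.
  have xE : x = (t + 1) *: normalize x.
    by rewrite /t subrK /normalize scalerA divff ?scale1r// enorm_eq0.
  move: (normalize x) xE (w x) (w p) => y xE wx w0.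
  by apply/rowP => i; rewrite {1}xE !mxE; ring.
apply: le_trans (ler_normD _ _) _; rewrite !normrZ.
apply: (@le_trans _ _ (d * D * `|x - p|)); last by rewrite ler_wpM2r.
rewrite /D mulrDr mulrDl lerD//.
  rewrite (_ : d * (2 * C) * _ = (C * `|x - p|) * (d + d)); last by ring.
  rewrite ler_pM//; apply: le_trans (ler_normB _ _) _.
  by rewrite lerD// ltW.
rewrite [leRHS](_ : _ = d * (m%:R + C ^+ 2) * `|x - p| / 2 * `|w p - p|); last first.
  by ring.
rewrite ler_wpM2r// (@ger0_norm _ 2^-1)// ler_wpM2r//.
apply: le_trans (ler_normB _ _) _; rewrite mulrDr mulrDl lerD//.
  apply: le_trans q_le _; rewrite expr2 mulrA [d * _]mulrC ler_wpM2r//.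
  by rewrite ler_wpM2l// ltW.
rewrite normrX; apply: (@le_trans _ _ ((C * `|x - p|) ^+ 2)).
  by rewrite lerXn2r// nnegrE// mulr_ge0.
rewrite exprMn [leRHS](_ : _ = C ^+ 2 * (d * `|x - p|)); last by ring.
by rewrite ler_wpM2l ?sqr_ge0// expr2 ler_wpM2r// ltW.
Unshelve. all: by end_near.
Qed.

End transversal.

(** * Tangent lines fill the exterior of the sphere *)

Section exterior.
Variables (R : realType) (m : nat).
Implicit Types (x y d e : 'rV[R]_m).

Definition orth e y : 'rV[R]_m := y - dot y e *: e.

Lemma dot_orth e y : enorm e = 1 -> dot (orth e y) e = 0.
Proof. by move=> e1; rewrite dotDl dotNl dotZl -(enorm_sqr e) e1 expr1n mulr1 subrr. Qed.

Lemma orth_id e y : dot y e = 0 -> orth e y = y.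
Proof. by rewrite /orth => ->; rewrite scale0r subr0. Qed.

Lemma for_continuous_orth (T : topologicalType) (t : T) e (f : T -> 'rV[R]_m) :
  {for t, continuous f} -> {for t, continuous (fun s => orth e (f s))}.
Proof.
move=> cf; apply: for_continuousB; first exact: cf.
apply: (@continuousZ _ _ _ (fun s => dot (f s) e) (fun=> e)).
  by apply: for_continuous_dot; [exact: cf|exact: cst_continuous].
exact: cst_continuous.
Qed.

(** Retracts the whole space onto the disc of radius r centred at 0 in the
hyperplane orthogonal to e. *)
Definition disc_retract e (r : R) y : 'rV[R]_m :=
  (Num.max 1 (enorm (orth e y) / r))^-1 *: orth e y.

Lemma disc_retract_continuous e r : continuous (disc_retract e r).
Proof.
move=> y; apply: (@continuousZ _ _ _ (fun y => (Num.max 1 (enorm (orth e y) / r))^-1)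
  (orth e)); last by apply: for_continuous_orth; exact: cvg_id.
apply: continuousV; first by rewrite gt_eqF// lt_max ltr01.
apply: (@continuous_max R _ (fun=> 1)); first exact: cst_continuous.
apply: for_continuousM; last exact: cst_continuous.
by apply: for_continuous_enorm; apply: for_continuous_orth; exact: cvg_id.
Qed.

Lemma enorm_disc_retract e r y : 0 < r -> enorm (disc_retract e r y) <= r.
Proof.
move=> r0; have s0 : 0 < Num.max 1 (enorm (orth e y) / r) by rewrite lt_max ltr01.
rewrite enormZ ger0_norm ?invr_ge0 ?(ltW s0)// ler_pdivrMl// -ler_pdivrMr//.
by rewrite le_max lexx orbT.
Qed.

Lemma dot_disc_retract e r y : enorm e = 1 -> dot (disc_retract e r y) e = 0.
Proof. by move=> e1; rewrite dotZl dot_orth// mulr0. Qed.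

Lemma norm_le_enorm y : `|y| <= enorm y.
Proof.
by apply: mx_norm_leP => [|i j]; [exact: enorm_ge0|rewrite ord1 coord_le_enorm].
Qed.

(** Let c be the retraction onto the disc.  The map c - (w o c)/|w o c| is bounded,
hence has a fixed point y, which lies in the hyperplane.  It is not in the disc,
since w does not vanish there; so c y is on the boundary, where
w (c y) is a positive multiple of c y - y and points to the centre. *)
Lemma disc_boundary_inward (w : 'rV[R]_m -> 'rV[R]_m) e (r : R) :
  enorm e = 1 -> 0 < r ->
  (forall d, `|d| <= r -> {for d, continuous w}) ->
  (forall d, dot d e = 0 -> `|d| <= r -> dot (w d) e = 0 /\ w d != 0) ->
  exists d, [/\ dot d e = 0, enorm d = r & exists2 mu, 0 < mu & w d = - mu *: d].
Proof.
move=> e1 r0 cw wP.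
pose c := disc_retract e r.
have cr y : enorm (c y) <= r by exact: enorm_disc_retract.
have cn y : `|c y| <= r := le_trans (norm_le_enorm _) (cr y).
have ce y : dot (c y) e = 0 by exact: dot_disc_retract.
have w0 y : w (c y) != 0 by have [] := wP _ (ce y) (cn y).
pose g y := c y - normalize (w (c y)).
have [y gy] : exists y, g y = y.
  apply: (@brouwer_bounded _ _ g (r + 1)).
    move=> y; apply: for_continuousB; first exact: disc_retract_continuous.
    apply: (@continuous_comp _ _ _ (fun y => w (c y)) (@normalize R m)).
      apply: (@continuous_comp _ _ _ c w); first exact: disc_retract_continuous.
      exact: cw.
    exact: normalize_continuous.
  move=> y; apply: le_trans (ler_normB _ _) _; apply: lerD => //.
  by rewrite -(enorm_normalize (w0 y)) norm_le_enorm.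
have ye : dot y e = 0.
  by rewrite -gy dotDl dotNl ce dotZl (wP _ (ce y) (cn y)).1 mulr0 subrr.
pose s := Num.max 1 (enorm y / r).
have s0 : 0 < s by rewrite lt_max ltr01.
have cE : c y = s^-1 *: y by rewrite /c /disc_retract orth_id.
have wE : normalize (w (c y)) = - (s - 1) *: c y.
  rewrite scaleNr scalerBl scale1r opprB {3}cE scalerA divff ?gt_eqF// scale1r.
  by rewrite -[X in _ = _ - X]gy /g subKr.
have s1 : 1 < s.
  rewrite lt_neqAle le_max lexx andbT eq_sym; apply/eqP => s1.
  have := enorm_normalize (w0 y); rewrite wE s1 subrr oppr0 scale0r => e01.
  by have := enorm_eq0 (0 : 'rV[R]_m); rewrite e01 eqxx oner_eq0.
exists (c y); split=> //.
  have sE : s = enorm y / r by move: s1; rewrite /s lt_max ltxx /= => /ltW/max_r.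
  have y0 : 0 < enorm y by move: s0; rewrite sE pmulr_lgt0 ?invr_gt0.
  rewrite cE enormZ ger0_norm ?invr_ge0 ?(ltW s0)// sE.
  by field; rewrite !gt_eqF.
have wn : 0 < enorm (w (c y)) by rewrite lt_neqAle enorm_ge0 eq_sym enorm_eq0 w0.
exists (enorm (w (c y)) * (s - 1)); first by rewrite mulr_gt0// subr_gt0.
rewrite -mulrN -scalerA -wE /normalize scalerA divff ?scale1r//.
by rewrite gt_eqF.
Qed.

(** Put e = x/|x|.  Central projection from the origin maps the hyperplane through
e orthogonal to e onto the open hemisphere, d |-> (e + d)/|e + d|, and the cap
visible from x corresponds to the disc |d|^2 <= |x|^2 - 1.  Take a nowhere zero
section v of the bundle over this disc.  Up to a positive factor, its image under
the differential of the inverse chart is w = v - (v.e)(e + d), which is nonzero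
because v is not radial.  At a boundary point where w = - mu d, orthogonality of v
to e + d determines v.e and gives v = (mu / |x|) (x - p). *)
Lemma tangent_lines_cover_exterior (M : 'rV[R]_m -> 'M[R]_m) x :
  (forall h : 'rV[R]_m -> 'rV[R]_m, continuous h -> (forall y, enorm (h y) = 1) ->
    continuous (fun y => M (h y))) ->
  (forall p, M p *m M p = M p) -> (forall p, M p != 0) ->
  (forall p u, enorm p = 1 -> u *m M p = u -> dot u p = 0) ->
  1 < enorm x ->
  exists2 p, enorm p = 1 & (x - p) *m M p = x - p.
Proof.
move=> cM MM M0 tM x1.
pose X := enorm x; pose e := normalize x.
have X0 : 0 < X by apply: lt_trans x1.
have x0 : x != 0 by rewrite -enorm_eq0 gt_eqF.
have e1 : enorm e = 1 by exact: enorm_normalize.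
have ee : dot e e = 1 by rewrite -enorm_sqr e1 expr1n.
have xE : x = X *: e by rewrite scalerA divff ?scale1r// gt_eqF.
pose q d := e + orth e d.
have qe d : dot (q d) e = 1 by rewrite dotDl dot_orth// addr0.
have q0 d : q d != 0.
  apply/eqP => q0; have := qe d; rewrite q0 /dot big1 => [/eqP|i _].
    by rewrite eq_sym oner_eq0.
  by rewrite mxE mul0r.
pose r := Num.sqrt (X ^+ 2 - 1).
have X21 : 0 < X ^+ 2 - 1 by rewrite subr_gt0 -(expr1n _ 2) ltrXn2r// nnegrE ltW.
have r0 : 0 < r by rewrite sqrtr_gt0.
have cq : continuous q.
  move=> d; apply: (@for_continuousD _ _ d _ (fun=> e) (orth e)).
    exact: cst_continuous.
  by apply: for_continuous_orth; exact: cvg_id.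
have nq d : enorm (normalize (q d)) = 1 by exact: enorm_normalize.
pose K d := M (normalize (q d)).
have cK : continuous K.
  apply: (cM (fun d => normalize (q d)) _ nq) => d.
  apply: (@continuous_comp _ _ _ q (@normalize R m)); first exact: cq.
  exact: normalize_continuous.
have [v cv vP] := exists_section (ltW r0) cK (fun d => MM _) (M0 _).
pose w d := v d - dot (v d) e *: q d.
have [||d [de dr [mu mu0 wd]]] := @disc_boundary_inward w e r e1 r0.
- move=> d _; apply: (@for_continuousB _ _ d _ v (fun d => dot (v d) e *: q d)).
    exact: cv.
  apply: (@continuousZ _ _ _ (fun d => dot (v d) e) q); last exact: cq.
  by apply: for_continuous_dot; [exact: cv|exact: cst_continuous].
- move=> d de dr; split; first by rewrite dotDl dotNl dotZl qe mulr1 subrr.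
  have [vK v0] := vP d dr; apply/eqP => /eqP; rewrite subr_eq0 => /eqP vE.
  have := tM _ _ (nq d) vK; rewrite dotZr => /eqP.
  rewrite mulf_eq0 invr_eq0 enorm_eq0 (negbTE (q0 d)) /= vE dotZl mulf_eq0 dot_eq0.
  rewrite (negbTE (q0 d)) orbF => /eqP ve.
  by move: v0; rewrite vE ve scale0r eqxx.
have dn : `|d| <= r by rewrite -dr norm_le_enorm.
have [vK v0] := vP d dn.
have qE : q d = e + d by rewrite /q orth_id.
have dd : dot d d = X ^+ 2 - 1 by rewrite -enorm_sqr dr sqr_sqrtr// ltW.
have qX : enorm (q d) = X.
  rewrite enormE qE dotDl !dotDr ee dd (dotC e d) de addr0 add0r addrC subrK.
  by rewrite sqrtr_sqr gtr0_norm.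
exists (normalize (q d)); first exact: nq.
have vq : dot (v d) (q d) = 0.
  have := tM _ _ (nq d) vK; rewrite dotZr => /eqP.
  by rewrite mulf_eq0 invr_eq0 enorm_eq0 (negbTE (q0 d)) => /eqP.
set a := dot (v d) e in wd *.
have vE : v d = a *: (e + d) - mu *: d.
  by rewrite -scaleNr -wd /w -/a qE addrC subrK.
(* The equation v.(e + d) = 0, with |d|^2 = X^2 - 1. *)
have aX : a * X ^+ 2 = mu * (X ^+ 2 - 1).
  have : dot (v d) d = a * (X ^+ 2 - 1) - mu * (X ^+ 2 - 1).
    by rewrite vE dotDl dotNl !dotZl dotDl (dotC e d) de dd add0r.
  move: vq; rewrite qE dotDr -/a => + H; rewrite H; lra.
suff -> : x - normalize (q d) = (X / mu) *: v d by rewrite -scalemxAl vK.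
rewrite /normalize qX vE xE qE; apply/rowP => i; rewrite !mxE.
have {aX} -> : a = mu * (X ^+ 2 - 1) / X ^+ 2 by rewrite -aX mulfK// expf_neq0// gt_eqF.
by field; rewrite !gt_eqF.
Qed.

End exterior.

(** * Tangent spaces of an ellipsoid *)

Lemma is_derive_mx (R : realType) m n (f : R -> 'M[R]_(m, n)) (t : R)
    (df : 'M[R]_(m, n)) :
  (forall i j, is_derive t (1 : R) (fun s => f s i j) (df i j)) ->
  is_derive t (1 : R) f df.
Proof.
move=> H; have fd : derivable f t 1 by apply/derivable_mxP => i j; have [] := H i j.
split=> //; rewrite derive_mx//; apply/matrixP => i j; rewrite mxE.
by have [] := H i j.
Qed.

Section tangent.
Variables (R : realType) (n : nat) (A : 'M[R]_n.+1) (b : 'rV[R]_n.+1).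
Hypothesis uA : A \in unitmx.

Lemma affine_transformK : cancel (affine_transform A b) (fun y => (y - b) *m invmx A).
Proof. by move=> x; rewrite /affine_transform addrK mulmxK. Qed.

Lemma affine_transformVK : cancel (fun y => (y - b) *m invmx A) (affine_transform A b).
Proof. by move=> x; rewrite /affine_transform mulmxKV// subrK. Qed.

(** In the coordinates where S is the unit sphere, let D h be the difference
quotient of the curve at q.  Expanding |q + h D h|^2 = 1 gives
2 (D h).q + h |D h|^2 = 0 for h != 0, and h tends to 0. *)
Lemma tangent_orthogonal (q u : 'rV[R]_n.+1) : enorm q = 1 ->
  tangent_space (ellipsoid A b) (affine_transform A b q) u ->
  dot (u *m invmx A) q = 0.
Proof.
move=> q1 [gamma [gS g0 [dg gu]]].
pose D (h : R) := (h^-1 *: (gamma h - gamma 0)) *m invmx A.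
have cD : D @ 0^' --> u *m invmx A.
  have cG : (fun h : R => h^-1 *: (gamma h - gamma 0)) @ 0^' --> u.
    have -> : (fun h : R => h^-1 *: (gamma h - gamma 0)) =
        (fun h : R => h^-1 *: ((gamma \o shift 0) (h *: 1) - gamma 0)).
      by apply/funext => h /=; rewrite addr0 [_ *: 1]mulr1.
    by rewrite -gu; exact: dg.
  have cA : {for u, continuous (fun v : 'rV[R]_n.+1 => v *m invmx A)}.
    by apply: for_continuous_mulmx; [exact: cvg_id|exact: cst_continuous].
  exact: (continuous_cvg _ cA cG).
have H : \forall h \near 0^', 2 * dot (D h) q + h * dot (D h) (D h) = 0.
  have gS' : \forall h \near 0^', ellipsoid A b (gamma h).
    by apply: nbhs_dnbhs; apply: filterS gS => t [].
  apply: filterS2 gS' (nbhs_dnbhs_neq (0 : R)) => h [c c1 ch] h0.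
  have Dh : c = q + h *: D h.
    rewrite /D -ch g0 /affine_transform opprD addrACA subrr addr0 -mulmxBl.
    rewrite -scalemxAl mulmxK//.
    by rewrite scalerA divff// scale1r addrC subrK.
  have := enorm_sqr c; rewrite c1 expr1n Dh !dotDl !dotDr !dotZl !dotZr.
  rewrite -(enorm_sqr q) q1 expr1n (dotC q) => E.
  by apply: (mulfI h0); rewrite mulr0; lra.
have cq : {for u *m invmx A, continuous (fun v : 'rV[R]_n.+1 => dot v q)}.
  by apply: for_continuous_dot; [exact: cvg_id|exact: cst_continuous].
have cn : {for u *m invmx A, continuous (fun v : 'rV[R]_n.+1 => dot v v)}.
  by apply: for_continuous_dot; exact: cvg_id.
have L : (fun h => 2 * dot (D h) q + h * dot (D h) (D h)) @ 0^' -->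
    2 * dot (u *m invmx A) q + 0 * dot (u *m invmx A) (u *m invmx A).
  apply: cvgD.
    apply: cvgM; first exact: cvg_cst.
    exact: (continuous_cvg _ cq cD).
  apply: cvgM; first exact: (@nbhs_dnbhs R 0).
  exact: (continuous_cvg _ cn cD).
have Z : (fun h => 2 * dot (D h) q + h * dot (D h) (D h)) @ 0^' --> 0.
  exact: cvg_near_cst.
have E : 2 * dot (u *m invmx A) q
    + 0 * dot (u *m invmx A) (u *m invmx A) = 0 :> R.
  have hR := @Rhausdorff R; exact: (etrans (esym (cvg_lim hR L)) (cvg_lim hR Z)).
by move: E; lra.
Qed.

(** The great circle cos(k t) q + sin(k t) e, with k = |u| and u = k e, has
velocity u at t = 0; for u = 0 it is constant. *)
Lemma orthogonal_tangent (q u : 'rV[R]_n.+1) : enorm q = 1 -> dot u q = 0 ->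
  tangent_space (ellipsoid A b) (affine_transform A b q) (u *m A).
Proof.
move=> q1 uq.
pose k := enorm u.
have [e [kE eq0 ee]] : exists e : 'rV[R]_n.+1,
    [/\ k *: e = u, dot e q = 0 & k != 0 -> enorm e = 1].
  exists (normalize u); rewrite /normalize dotZl uq mulr0; split=> // [|k0].
    rewrite scalerA -/k; have [k0|k0] := eqVneq k 0; last by rewrite divff ?scale1r.
    by rewrite k0 mul0r scale0r; apply/esym/eqP; rewrite -enorm_eq0 -/k k0.
  by apply: enorm_normalize; rewrite -enorm_eq0.
pose c (t : R) := cos (k * t) *: q + sin (k * t) *: e.
have c1 t : enorm (c t) = 1.
  rewrite enormE dotDl !dotDr !dotZl !dotZr (dotC q e) -!enorm_sqr q1 eq0.
  have [k0|/ee ->] := eqVneq k 0.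
    by rewrite k0 mul0r sin0 cos0 !(mulr0, mul0r, addr0, add0r, mul1r, expr1n) sqrtr1.
  rewrite expr1n !(mulr0, mulr1, addr0, add0r).
  by rewrite -!expr2 cos2Dsin2 sqrtr1.
have dc (t : R) : is_derive t (1 : R) (fun t => affine_transform A b (c t))
    ((- sin (k * t) *: (k *: q) + cos (k * t) *: u) *m A).
  apply: is_derive_mx => i j.
  have -> : (fun s => affine_transform A b (c s) i j) =
     (fun s => (q *m A) i j * cos (k * s) + (e *m A) i j * sin (k * s) + b i j).
    apply/funext => s; rewrite /affine_transform /c mulmxDl -!scalemxAl !mxE.
    by rewrite !(mulrC (_ (k * s))).
  have dk : is_derive t (1 : R) (fun s => k * s) (k * 1).
    exact: (@is_deriveZ _ _ _ (@id R) k t 1 1).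
  have dcos := is_derive1_comp (is_derive_cos (k * t)) dk.
  have dsin := is_derive1_comp (is_derive_sin (k * t)) dk.
  have := is_deriveD (is_deriveD (is_deriveZ ((q *m A) i j) dcos)
    (is_deriveZ ((e *m A) i j) dsin)) (is_derive_cst (b i j) t 1).
  move=> H; apply: (is_derive_eq H).
  rewrite -kE mulmxDl -!scalemxAl !mxE /GRing.scale /=; ring.
exists (fun t => affine_transform A b (c t)); split.
- exists 1 => //= t _; split; first by exists (c t); [exact: c1|].
  by have [] := dc t.
- by rewrite /c mulr0 cos0 sin0 scale1r scale0r addr0.
- have := dc 0; rewrite mulr0 sin0 cos0 oppr0 scale0r add0r scale1r; exact.
Qed.
End tangent.

(** * Line bundles over an ellipsoid *)

Section ellipsoid_bundles.
Variables (R : realType) (n : nat) (A : 'M[R]_n.+1) (b : 'rV[R]_n.+1).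
Hypothesis uA : A \in unitmx.

Lemma for_continuous_affineV (z : 'rV[R]_n.+1) :
  {for z, continuous (fun y : 'rV[R]_n.+1 => (y - b) *m invmx A)}.
Proof.
apply: for_continuous_mulmx; last exact: cst_continuous.
by apply: for_continuousB; [exact: cvg_id|exact: cst_continuous].
Qed.

Lemma for_continuous_affine (T : topologicalType) (t : T) (h : T -> 'rV[R]_n.+1) :
  {for t, continuous h} -> {for t, continuous (fun s => affine_transform A b (h s))}.
Proof.
move=> ch; apply: for_continuousD; last exact: cst_continuous.
by apply: for_continuous_mulmx; [exact: ch|exact: cst_continuous].
Qed.

(** A projection onto the line at q, in general oblique, once the ellipsoid has
been straightened to the unit sphere. *)
Definition bundle_mx (phi : 'rV[R]_n.+1 -> Gr1 R n) (q : 'rV[R]_n.+1) : 'M[R]_n.+1 :=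
  A *m line_proj (phi (affine_transform A b q)) *m invmx A.

Lemma bundle_mx_idem phi q : bundle_mx phi q *m bundle_mx phi q = bundle_mx phi q.
Proof.
by rewrite /bundle_mx !mulmxA mulmxKV// -(mulmxA A) line_proj_idem.
Qed.

Lemma bundle_mx_neq0 phi q : bundle_mx phi q != 0.
Proof.
apply: contraNneq (line_proj_neq0 (phi (affine_transform A b q))) => M0.
have := congr1 (fun M => invmx A *m (M *m A)) M0.
by rewrite /bundle_mx mulmxKV// mulKmx// mul0mx mulmx0 => ->.
Qed.

Lemma bundle_mxP phi q u :
  u *m bundle_mx phi q = u <-> u *m A \in val (phi (affine_transform A b q)).
Proof.
rewrite /bundle_mx !mulmxA; split=> [uE|/mem_lineP ->]; last by rewrite mulmxK.
by apply/mem_lineP; rewrite -{2}uE mulmxKV.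
Qed.

Lemma for_continuous_bundle_mx (T : topologicalType) (X : set 'rV[R]_n.+1) phi
    (h : T -> 'rV[R]_n.+1) (t : T) :
  {within X, continuous phi} -> {for t, continuous h} ->
  (\forall s \near t, X (affine_transform A b (h s))) ->
  {for t, continuous (fun s => bundle_mx phi (h s))}.
Proof.
move=> cphi ch Xh.
apply: for_continuous_mulmx; last exact: cst_continuous.
apply: for_continuous_mulmx; first exact: cst_continuous.
apply: (@continuous_comp _ _ _ (fun s => phi (affine_transform A b (h s)))
  (@line_proj R n)); last exact: line_proj_continuous.
by apply: for_continuous_within cphi _ Xh; exact: for_continuous_affine.
Qed.

Lemma nontangent_bundle_interior (U V : set 'rV[R]_n.+1) phi :
  open V -> U = ellipsoid A b `&` V -> {within U, continuous phi} ->
  ~ tangent_bundle (ellipsoid A b) U phi ->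
  interior (@codiagonal R n @` bundle U phi) !=set0.
Proof.
move=> oV UE cphi /existsNP[p /not_implyP[Up /existsNP[u /not_implyP[pu nu]]]].
move: (Up); rewrite UE => -[[q q1 qp] Vp].
pose u' := u *m invmx A.
have uE : u' *m A = u by rewrite mulmxKV.
have uq : dot u' q != 0.
  apply/eqP => uq; apply: nu; rewrite -qp -uE; exact: orthogonal_tangent.
have q0 : q != 0 by rewrite -enorm_eq0 q1 oner_eq0.
pose O := [set x : 'rV[R]_n.+1 | x != 0 /\ V (affine_transform A b (normalize x))].
have nO x : O x -> nbhs x O.
  move=> [x0 Vx]; apply: filterI.
    apply: (@open_nbhs_nbhs _ x [set x | x != 0]); split=> //.
    rewrite (_ : mkset _ = ~` [set 0]); last by apply/seteqP; split=> w /= /eqP.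
    exact/closed_openC/accessible_closed_set1/hausdorff_accessible/norm_hausdorff.
  have := for_continuous_affine (normalize_continuous x0).
  by apply; exact: open_nbhs_nbhs.
have OU x : O x -> U (affine_transform A b (normalize x)).
  move=> [x0 Vx]; rewrite UE; split=> //; exists (normalize x) => //.
  exact: enorm_normalize.
pose w x := u' *m bundle_mx phi (normalize x).
have Oq : O q by split; rewrite ?normalize_id// qp.
have wq : w q = u'.
  by rewrite /w normalize_id//; apply/bundle_mxP; rewrite uE qp.
exists p; rewrite /interior /=.
have := @transversal_lines_cover R n.+1 w q O q1 (nO _ Oq) (fun x Ox => Ox.1).
rewrite wq => /(_ _ uq) cover.
have {}cover : nbhs q [set z | exists2 x, O x &
    exists t, z = normalize x + t *: w x].
  apply: cover => x Ox.
  apply: (@for_continuous_mulmx _ _ _ _ _ _ (fun=> u')); first exact: cst_continuous.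
  apply: (for_continuous_bundle_mx cphi (normalize_continuous Ox.1)).
  by apply: filterS (nO _ Ox) => y /OU.
have qE : (p - b) *m invmx A = q by rewrite -qp affine_transformK.
have nz : \forall z \near p, exists2 x, O x &
    exists t, (z - b) *m invmx A = normalize x + t *: w x.
  by move: cover; rewrite -{1}qE => /(for_continuous_affineV (z := p)).
apply: filterS nz => z /= [x Ox [t zE]].
exists (affine_transform A b (normalize x), t *: w x *m A); last first.
  rewrite -[RHS](affine_transformVK b uA) zE /codiagonal /affine_transform /=.
  by rewrite mulmxDl addrAC.
split=> /=; first by have := OU _ Ox; rewrite UE.
by apply/bundle_mxP; rewrite -scalemxAl /w -mulmxA bundle_mx_idem.
Qed.

Lemma tangent_bundle_fills_exterior phi :
  line_distribution (ellipsoid A b) phi ->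
  @codiagonal R n @` bundle (ellipsoid A b) phi = ~` ellipsoid_region A b.
Proof.
move=> [cphi tphi].
have tM p u : enorm p = 1 -> u *m bundle_mx phi p = u -> dot u p = 0.
  move=> p1 /bundle_mxP uphi; rewrite -[u](mulmxK uA).
  apply: tangent_orthogonal => //; apply: tphi => //.
  by exists p.
apply/seteqP; split=> [z [[p u] [/= [q q1 qp] uphi] <-]|z nz].
  move: uphi; rewrite -{p}qp => uphi [x x1]; rewrite /codiagonal /= => xE.
  have yq : dot (u *m invmx A) q = 0.
    by apply: tM => //; apply/bundle_mxP; rewrite mulmxKV.
  have {xE} : x = q + u *m invmx A.
    apply: (can_inj (affine_transformK b uA)); rewrite xE /affine_transform.
    by rewrite mulmxDl mulmxKV// addrAC.
  move: (u *m invmx A) yq => y yq xE.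
  have : enorm x ^+ 2 < 1 by rewrite expr_lt1// enorm_ge0.
  rewrite enorm_sqr xE dotDl !dotDr (dotC q y) yq -(enorm_sqr q) q1 expr1n.
  by rewrite addr0 add0r gtrDl ltNge dot_ge0.
pose x := (z - b) *m invmx A.
have zE : z = affine_transform A b x by rewrite affine_transformVK.
have : 1 <= enorm x by rewrite leNgt; apply/negP => x1; apply: nz; exists x.
rewrite le_eqVlt => /orP[/eqP x1|x1].
  exists (z, 0); last by rewrite /codiagonal /= addr0.
  by split=> /=; [exists x|exact: mem0v].
have [|||p p1 pM] := @tangent_lines_cover_exterior _ _ (bundle_mx phi) x _ _ _ tM x1.
- move=> h ch h1 y; apply: (for_continuous_bundle_mx cphi); first exact: ch.
  by apply: filterE => s; exists (h s) => //; exact: h1.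
- exact: bundle_mx_idem.
- exact: bundle_mx_neq0.
exists (affine_transform A b p, (x - p) *m A).
  by split=> /=; [exists p|apply/bundle_mxP].
by rewrite zE /codiagonal /affine_transform /= addrAC -mulmxDl subrKC.
Qed.

Lemma exterior_interior : interior (~` ellipsoid_region A b) !=set0.
Proof.
pose x0 : 'rV[R]_n.+1 := const_mx 2.
have x01 : 1 < enorm x0.
  apply: lt_le_trans (coord_le_enorm x0 0).
  by rewrite mxE ger0_norm// ltr1n.
exists (affine_transform A b x0); rewrite /interior /=.
have c : {for affine_transform A b x0,
    continuous (fun z : 'rV[R]_n.+1 => enorm ((z - b) *m invmx A) : R)}.
  by apply: for_continuous_enorm; exact: for_continuous_affineV.
have near1 : \forall z \near affine_transform A b x0,
    1 < enorm ((z - b) *m invmx A).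
  have n1 : nbhs (enorm ((affine_transform A b x0 - b) *m invmx A)) [set r | 1 < r].
    by rewrite affine_transformK//; exact: lt_nbhsr.
  exact: (c _ n1).
apply: filterS near1 => z /= z1 [x x1 xz]; move: z1.
by rewrite -xz affine_transformK// ltNge ltW.
Qed.

End ellipsoid_bundles.

Theorem mainTheorem11 (R : realType) (n : nat) (A : 'M[R]_n.+1)
    (b : 'rV[R]_n.+1) (S B : set 'rV[R]_n.+1) :
  A \in unitmx -> S = ellipsoid A b -> B = ellipsoid_region A b ->
  [/\ forall (U : set 'rV[R]_n.+1) (phi : 'rV[R]_n.+1 -> Gr1 R n),
        (exists2 V : set 'rV[R]_n.+1, open V & U = S `&` V) ->
        {within U, continuous phi} ->
        ~ tangent_bundle S U phi ->
        interior (@codiagonal R n @` bundle U phi) !=set0,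
      (1 <= n)%N ->
        forall phi : 'rV[R]_n.+1 -> Gr1 R n,
        line_distribution S phi ->
        @codiagonal R n @` bundle S phi = ~` B &
      forall phi : 'rV[R]_n.+1 -> Gr1 R n,
        {within S, continuous phi} ->
        interior (@codiagonal R n @` bundle S phi) !=set0].
Proof.
move=> uA -> ->; split.
- by move=> U phi [V oV UE]; exact: nontangent_bundle_interior oV UE.
- by move=> _ phi; exact: tangent_bundle_fills_exterior.
move=> phi cphi.
have [tphi|ntphi] := pselect (tangent_bundle (ellipsoid A b) (ellipsoid A b) phi).
  rewrite tangent_bundle_fills_exterior//; exact: exterior_interior.
exact: (nontangent_bundle_interior uA openT (esym (setIT _)) cphi ntphi).
Qed.
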